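(* For every integer $n \geq 5$, let $\delta(n)$ denote the maximum of $\delta(T)$ over all tournaments $T$ with $n$ vertices. Then $\delta(n) = \left\lceil \frac{n+1}{4} \right\rceil$.
   Context: A tournament $T$ is a finite vertex set $V(T)$ with an arc set $A(T)$ of ordered pairs of distinct vertices such that for all distinct $x,y$, exactly one of $(x,y),(y,x)$ lies in $A(T)$. A module of $T$ is a subset $M \subseteq V(T)$ such that for all $x,y \in M$ and $v \in V(T)\setminus M$, $(v,x)\in A(T)$ iff $(v,y)\in A(T)$. The trivial modules are $\emptyset$, the singletons and $V(T)$; $T$ is indecomposable if all its modules are trivial, decomposable otherwise. For $B \subseteq A(T)$, ${\rm Inv}(T,B)$ is the tournament obtained from $T$ by reversing every arc of $B$. For a tournament $T$ with at least five vertices, the decomposability index $\delta(T)$ is the least integer $m$ such that there is $B \subseteq A(T)$ with $|B| = m$ and ${\rm Inv}(T,B)$ indecomposable. *)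

(* Defs.v *)
From mathcomp Require Import all_boot.

Set Implicit Arguments.
Unset Strict Implicit.
Unset Printing Implicit Defensive.

Section Tournaments.

Variable V : finType.

(* [(+)] is exclusive or: exactly one of the two arcs is present. *)
Record tournament := Tournament {
  arcs : {set V * V};
  arcs_irr : forall x, (x, x) \notin arcs;
  arcs_tot : forall x y, x != y -> ((x, y) \in arcs) (+) ((y, x) \in arcs)
}.

Definition is_module (T : tournament) (M : {set V}) : Prop :=
  forall x y v, x \in M -> y \in M -> v \notin M ->
    ((v, x) \in arcs T) = ((v, y) \in arcs T).

Definition trivial_module (M : {set V}) : Prop :=
  [\/ M = set0, exists x, M = [set x] | M = setT].

Definition indecomposable (T : tournament) : Prop :=
  forall M : {set V}, is_module T M -> trivial_module M.

Definition inv_arcs (T : tournament) (B : {set V * V}) : {set V * V} :=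
  (arcs T :\: B) :|: [set (e.2, e.1) | e in B].

Lemma in_inv_arcs T B x y : ((x, y) \in inv_arcs T B) =
  ((x, y) \in arcs T) && ((x, y) \notin B) || ((y, x) \in B).
Proof.
rewrite /inv_arcs !inE andbC; congr (_ || _).
apply/imsetP/idP => [[[a b] abB [-> ->]] // | yxB].
by exists (y, x).
Qed.

Lemma inv_arcs_irr (T : tournament) (B : {set V * V}) :
  B \subset arcs T -> forall x, (x, x) \notin inv_arcs T B.
Proof.
move=> sBT x; rewrite in_inv_arcs (negbTE (arcs_irr T x)) /=.
by apply: contra (arcs_irr T x); apply: (subsetP sBT).
Qed.

Lemma inv_arcs_tot (T : tournament) (B : {set V * V}) :
  B \subset arcs T -> forall x y, x != y ->
  ((x, y) \in inv_arcs T B) (+) ((y, x) \in inv_arcs T B).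
Proof.
move=> sBT x y /(arcs_tot T); rewrite !in_inv_arcs.
move/subsetP: sBT => sBT; have := sBT (x, y); have := sBT (y, x).
by do 4![case: (_ \in _)] => //= h1 h2; rewrite ?(h1 isT) ?(h2 isT).
Qed.

Definition Inv (T : tournament) (B : {set V * V}) (sBT : B \subset arcs T) :
    tournament :=
  Tournament (inv_arcs_irr sBT) (inv_arcs_tot sBT).

Definition indec_after (T : tournament) (m : nat) : Prop :=
  exists (B : {set V * V}) (sBT : B \subset arcs T),
    #|B| = m /\ indecomposable (Inv sBT).

(* delta(T) = m.  A relation rather than a function, since that some m is
   reachable at all (true from five vertices on) is not evident. *)
Definition decomposability_index (T : tournament) (m : nat) : Prop :=
  indec_after T m /\ forall k, indec_after T k -> m <= k.

End Tournaments.

(* delta(n) = m: delta(T) is defined and at most m for every tournament T on n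
   vertices, and the value m is attained. *)
Definition max_decomposability_index (n m : nat) : Prop :=
  (exists (V : finType) (T : tournament V),
      #|V| = n /\ decomposability_index T m) /\
  (forall (V : finType) (T : tournament V), #|V| = n ->
      exists k, decomposability_index T k /\ k <= m).

Definition ceil_div (m d : nat) : nat := (m + d.-1) %/ d.

Lemma ceil_div_leq m d q : 0 < d -> (ceil_div m d <= q) = (m <= q * d).
Proof.
case: d => // d _; rewrite /ceil_div -ltnS ltn_divLR // mulSn /=.
by rewrite addnC addSn ltnS leq_add2l.
Qed.

(* Main.v *)
(** Call a set a comodule if it or its complement is a nontrivial module, and
    let S be a set of vertices meeting every comodule.

    Upper bound.  Distinct minimal comodules that meet are two-element modules,
    whose vertices have out-degrees of opposite parity; hence one vertex per
    remaining minimal comodule (at most two of which are singletons) and the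
    smaller of two parity classes give such an S with 2|S| <= n+2.  If S is
    minimal, each x in S has a private comodule, meeting S in x only, and at
    most one x has none that is a module or a singleton.  Reverse the arc
    between x and y in S.  A new module meeting S in x only must be a pair
    {x, z} whose members x and z were told apart by y alone, and then x together
    with the private module of y is a module.  So S minus {x, y} meets every
    comodule of the new tournament unless some comodule meets S in {x, y}, and
    among four vertices of S the three splits into pairs cannot all be realised
    by comodules.  Thus one reversal saves two elements while |S| >= 4; the
    cases |S| = 3 and |S| = 2 are treated separately, and S empty means
    indecomposable.

    Lower bound.  In a transitive tournament the reversed arcs must touch both
    extreme vertices and one vertex of each consecutive pair. *)

Require Import Defs.
From mathcomp Require Import all_boot.
From mathcomp Require Import zify.

Set Implicit Arguments.
Unset Strict Implicit.
Unset Printing Implicit Defensive.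

(** * Elementary facts on finite sets *)

Lemma mem_neq (V : finType) (A : {set V}) a b : a \in A -> b \notin A -> a != b.
Proof. by move=> aA; apply: contraNneq => <-. Qed.

Lemma card_gt1_other (V : finType) (A : {set V}) x :
  1 < #|A| -> exists2 z, z \in A & z != x.
Proof.
case/card_gt1P => a [b [aA bA ab]]; case: (eqVneq a x) => [ax|]; last by exists a.
by exists b => //; rewrite -ax eq_sym.
Qed.

Lemma third_elt (V : finType) (A : {set V}) x y :
  2 < #|A| -> exists w, [/\ w \in A, w != x & w != y].
Proof.
move=> A3; have : 0 < #|A :\: [set x; y]|.
  have h1 := subset_leq_card (subsetIr A [set x; y]).
  have h2 : #|[set x; y]| <= 2 by rewrite cards2; case: (_ == _).
  by have := cardsID [set x; y] A; lia.
by case/card_gt0P => w; rewrite !inE negb_or => /andP[/andP[? ?] ?]; exists w.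
Qed.

(** * Modules, comodules and hitting sets of a tournament given as a relation *)

Definition is_tour (V : finType) (t : rel V) : Prop :=
  irreflexive t /\ forall x y, x != y -> t y x = ~~ t x y.

(** Boolean and over a bare relation, so that [minset] applies to comodules and hitting sets, and
    reversing an arc is a mere change of relation. *)
Definition modl (V : finType) (t : rel V) (M : {set V}) : bool :=
  [forall x in M, forall y in M, forall v, (v \notin M) ==> (t v x == t v y)].

Definition nmod (V : finType) (t : rel V) (M : {set V}) : bool :=
  [&& modl t M, 1 < #|M| & M != setT].

Definition comod (V : finType) (t : rel V) (C : {set V}) : bool :=
  nmod t C || nmod t (~: C).

Definition hits (V : finType) (t : rel V) (S : {set V}) : bool :=
  [forall C, comod t C ==> (S :&: C != set0)].

Section Modules.

Variables (V : finType) (t : rel V).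
Hypothesis ht : is_tour t.
Implicit Types (A B C D K M N S : {set V}) (u v w x y z m : V).

Lemma tour_sym x y : x != y -> t y x = ~~ t x y.
Proof. by case: ht => _; apply. Qed.

Lemma modlP M : reflect
  (forall x y v, x \in M -> y \in M -> v \notin M -> t v x = t v y) (modl t M).
Proof.
apply: (iffP idP) => [h x y v xM yM vM | h].
  by apply/eqP; move/forall_inP/(_ _ xM)/forall_inP/(_ _ yM)/forallP/(_ v)/implyP: h; apply.
by do 2![apply/forall_inP => ? ?]; apply/forallP => v; apply/implyP => vM; apply/eqP/h.
Qed.

Lemma modl_in M x y v :
  modl t M -> x \in M -> y \in M -> v \notin M -> t v x = t v y.
Proof. by move/modlP; apply. Qed.

Lemma modl_out M x y v :
  modl t M -> x \in M -> y \in M -> v \notin M -> t x v = t y v.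
Proof.
move=> hM xM yM vM; have e := modl_in hM xM yM vM.
rewrite (@tour_sym v x) 1?(@tour_sym v y) ?e // eq_sym; exact: mem_neq vM.
Qed.

Lemma modlI A B : modl t A -> modl t B -> modl t (A :&: B).
Proof.
move=> hA hB; apply/modlP => x y v /setIP[xA xB] /setIP[yA yB].
by rewrite inE negb_and => /orP[]; [apply: modl_in hA _ _ | apply: modl_in hB _ _].
Qed.

Lemma modlU A B x : x \in A -> x \in B -> modl t A -> modl t B -> modl t (A :|: B).
Proof.
move=> xA xB hA hB; apply/modlP => a b v aU bU.
rewrite inE negb_or => /andP[vA vB].
have h c : c \in A :|: B -> t v c = t v x.
  by case/setUP => cc; [apply: modl_in hA _ _ _ | apply: modl_in hB _ _ _].
by rewrite !h.
Qed.

(** Vertices of [A :\: B] see a vertex of [A :&: B] just as they see [z], and [z], lying outside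
    [A], does not tell them apart. *)
Lemma modlD A B z : z \in B -> z \notin A -> modl t A -> modl t B -> modl t (A :\: B).
Proof.
move=> zB zA hA hB; apply/modlP => a b v /setDP[aA aB] /setDP[bA bB] vD.
case: (boolP (v \in A)) => vA; last exact: modl_in hA _ _ vA.
have vB : v \in B by move: vD; rewrite inE vA andbT negbK.
by rewrite (modl_out hB vB zB aB) (modl_out hB vB zB bB) (modl_in hA aA bA zA).
Qed.

Lemma nmodE M : nmod t M -> [/\ modl t M, 1 < #|M| & M != setT].
Proof. by case/and3P. Qed.

Lemma nmod_intro M x y v :
  modl t M -> x \in M -> y \in M -> x != y -> v \notin M -> nmod t M.
Proof.
move=> hM xM yM xy vM; apply/and3P; split => //.
  by apply/card_gt1P; exists x, y.
by apply: contraNneq vM => ->; rewrite inE.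
Qed.

Lemma comodC C : comod t (~: C) = comod t C.
Proof. by rewrite /comod setCK orbC. Qed.

Lemma comod_neq0 C : comod t C -> exists x, x \in C.
Proof.
move=> h; apply/set0Pn; case/orP: h => /nmodE[_ h1 h2].
  by rewrite -card_gt0; lia.
by apply: contraNneq h2 => ->; rewrite setC0.
Qed.

(** A singleton is a comodule only through its complement, so its vertex is a source or a sink. *)
Lemma comod_sees C x y v : comod t C -> x \notin C -> y \notin C ->
   C = [set v] -> t v x = t v y.
Proof.
move=> h xC yC e; case/orP: h => /nmodE[hM h1 _].
  by move: h1; rewrite e cards1.
by apply: (modl_in hM); rewrite ?inE ?e ?xC ?yC ?negbK ?inE // -?in_set1 -?e.
Qed.

Lemma hitsP S : reflect (forall C, comod t C -> exists2 x, x \in S & x \in C) (hits t S).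
Proof.
apply: (iffP idP) => [h C hC | h].
  by move/forallP/(_ C)/implyP/(_ hC)/set0Pn: h => [x /setIP[]]; exists x.
apply/forallP => C; apply/implyP => /h [x xS xC]; apply/set0Pn; exists x.
by rewrite inE xS.
Qed.

Lemma hits_out S C : hits t S -> comod t C -> exists2 x, x \in S & x \notin C.
Proof.
move=> hS hC; have /(hitsP _ hS) [x xS xC] : comod t (~: C) by rewrite comodC.
by exists x => //; rewrite -in_setC.
Qed.

(** With two elements, [M] would be a nontrivial module that [S] misses. *)
Lemma hits_free S M x y : hits t S -> modl t M -> (forall s, s \in S -> s \notin M) ->
  S != set0 -> x \in M -> y \in M -> x = y.
Proof.
move=> hS hM hd /set0Pn[s sS] xM yM; apply/eqP; apply: contraT => xy.
have hc : comod t M by rewrite /comod (nmod_intro hM xM yM xy (hd _ sS)).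
by have [u uS uM] := hitsP _ hS _ hc; move: (hd _ uS); rewrite uM.
Qed.

(** If [M] were proper, its complement would be a comodule that [S] misses. *)
Lemma hits_full S M v : hits t S -> modl t M -> S \subset M ->
  1 < #|S| -> v \in M.
Proof.
move=> hS hM sM s1; apply: contraT => vM.
have hc : comod t M.
  rewrite /comod /nmod hM (leq_trans s1 (subset_leq_card sM)) /=.
  by apply/orP; left; apply: contraNneq vM => ->; rewrite inE.
by have [x xS] := hits_out hS hc; rewrite (subsetP sM _ xS).
Qed.

(** By minimality [S :\ x] misses some comodule, which [S] then meets in [x] only. *)
Lemma hits_private S x : minset (hits t) S -> x \in S ->
  exists2 M, comod t M & M :&: S = [set x].
Proof.
case/minsetP => hS hmin xS.
have nh : ~~ hits t (S :\ x).
  apply/negP => /hmin /(_ (subsetDl _ _)) e; move: xS; by rewrite -e !inE eqxx.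
move: nh; rewrite /hits negb_forall => /existsP[C].
rewrite negb_imply negbK => /andP[hC /eqP e]; exists C => //.
have [s sS sC] := hitsP _ hS _ hC.
have h u : u \in S -> u \in C -> u = x.
  move=> uS uC; apply/eqP; apply: contraT => ux.
  have : u \in (S :\ x) :&: C by rewrite !inE ux uS.
  by rewrite e inE.
apply/setP => u; rewrite !inE; apply/andP/eqP => [[uC uS]|->]; first exact: h.
by rewrite xS -(h s sS sC).
Qed.

End Modules.

(** * Modules created by reversing one arc *)

Definition flip (V : finType) (t : rel V) (x y : V) : rel V :=
  fun u v => t u v (+) ((u == x) && (v == y) || (u == y) && (v == x)).

(* Such an [N] is exactly a module of [flip t x y] separating [x] from [y]. *)
Definition almost (V : finType) (t : rel V) (x y : V) (N : {set V}) : Prop :=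
  [/\ x \in N, y \notin N,
      forall u v w, u \in N -> v \in N -> w \notin N -> w != y -> t w u = t w v
    & forall u, u \in N -> u != x -> t y u = ~~ t y x].

(** [x] and [z] are told apart by [y] alone, so [[set x; z]] turns into a module when the arc
    between [x] and [y] is reversed. *)
Definition twin (V : finType) (t : rel V) (x y z : V) : Prop :=
  [/\ z != x, z != y, t z y = ~~ t x y
    & forall v, v != x -> v != y -> v != z -> t x v = t z v].

(* The singletons of interest are comodules: a source or a sink. *)
Definition noncomp (V : finType) (t : rel V) (M : {set V}) : bool :=
  nmod t M || (#|M| == 1).

Section Flips.

Variables (V : finType) (t : rel V).
Hypothesis ht : is_tour t.
Implicit Types (A B C D K M N S : {set V}) (u v w x y z m : V).

Lemma flip_tour x y : x != y -> is_tour (flip t x y).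
Proof.
move=> xy; case: ht => hi hs; split => [u|u v uv]; rewrite /flip.
  rewrite hi /=; case: (eqVneq u x) => [->|_] /=; last by rewrite andbF.
  by rewrite (negbTE xy).
by rewrite (hs _ _ uv) addNb [in LHS]orbC; congr (~~ (_ (+) _)); rewrite ![_ && (u == _)]andbC.
Qed.

Lemma flipC x y : flip t x y =2 flip t y x.
Proof. by move=> u v; rewrite /flip orbC. Qed.

Lemma flip_almost x y N : x \in N -> y \notin N -> modl (flip t x y) N -> almost t x y N.
Proof.
move=> xN yN /modlP h; split=> // [u v w uN vN wN wy|u uN ux].
  have := h u v w uN vN wN; rewrite /flip (negbTE wy) /=.
  suff -> : (w == x) = false by rewrite !addbF.
  by apply: contraNF wN => /eqP->.
have yx : y != x by apply: contraNneq yN => ->.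
have := h u x y uN xN yN.
by rewrite /flip (negbTE yx) eqxx (negbTE ux) /= eqxx addbF addbT.
Qed.

(** If [N] contains both or neither of [x] and [y], the reversed arc does not join [N] to its
    complement, so [N] was a module already. *)
Lemma flip_modl x y N : x != y -> modl (flip t x y) N ->
  [\/ (x \in N) = (y \in N) /\ modl t N, almost t x y N | almost t y x N].
Proof.
move=> xy h; case: (boolP (x \in N)) => xN; case: (boolP (y \in N)) => yN.
- apply: Or31; split=> //; apply/modlP => u v w uN vN wN.
  have := modl_in h uN vN wN; rewrite /flip.
  have [/negbTE -> /negbTE ->] : w != x /\ w != y.
    by split; rewrite eq_sym; [apply: mem_neq xN _ | apply: mem_neq yN _].
  by rewrite !addbF.
- exact/Or32/flip_almost.
- apply/Or33/flip_almost => //; apply/modlP => u v w uN vN wN.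
  by rewrite !(flipC y x); apply: modl_in h _ _ _.
- apply: Or31; split=> //; apply/modlP => u v w uN vN wN.
  have := modl_in h uN vN wN; rewrite /flip.
  have n1 := mem_neq uN xN; have n2 := mem_neq uN yN.
  have n3 := mem_neq vN xN; have n4 := mem_neq vN yN.
  by rewrite (negbTE n1) (negbTE n2) (negbTE n3) (negbTE n4) !andbF !addbF.
Qed.

Lemma almost_out x y N u v w : almost t x y N ->
  u \in N -> v \in N -> w \notin N -> w != y -> t u w = t v w.
Proof.
case=> _ _ h _ uN vN wN wy.
have wu : w != u by rewrite eq_sym (mem_neq uN wN).
have wv : w != v by rewrite eq_sym (mem_neq vN wN).
by rewrite (tour_sym ht wu) (tour_sym ht wv) (h u v).
Qed.

Lemma almost_outy x y N u : almost t x y N -> u \in N -> u != x -> t u y = ~~ t x y.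
Proof.
case=> xN yN _ h uN ux.
have yu : y != u by rewrite eq_sym (mem_neq uN yN).
have yx : y != x by rewrite eq_sym (mem_neq xN yN).
by rewrite (tour_sym ht yu) (tour_sym ht yx) h.
Qed.

(** Once [x] leaves [N], both critical vertices see the rest uniformly: [y] because [x] was its only
    exception, [x] by the hypothesis on [b]. *)
Lemma almost_rest x y N b : almost t x y N ->
  (forall z, z \in N -> z != x -> t x z = b) -> modl t (N :\ x).
Proof.
case=> xN yN h1 h2 hb; apply/modlP => u v w /setD1P[ux uN] /setD1P[vx vN] wN.
case: (eqVneq w x) => [->|wx]; first by rewrite !hb.
have {}wN : w \notin N by move: wN; rewrite !inE wx.
by case: (eqVneq w y) => [->|wy]; [rewrite (h2 u) // (h2 v) | apply: h1].
Qed.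

Lemma trace1P S M x : M :&: S = [set x] ->
  [/\ x \in M, x \in S & forall s, s \in S -> s \in M -> s = x].
Proof.
move/setP => e; have := e x; rewrite !inE eqxx => /andP[xM xS]; split=> // s sS sM.
by have := e s; rewrite !inE sS sM => /esym/eqP.
Qed.

(** The private comodule [M] forces [x] to see [N :\ x] uniformly; so [N :\ x] is a module missed by
    [S], hence a single vertex. The final disjunction expresses the direction of the arc between [x]
    and [z] through [M]. *)
Lemma almost_pair S M N x y : hits t S -> x != y -> y \in S -> almost t x y N ->
  1 < #|N| -> N :&: S = [set x] -> comod t M -> noncomp t M -> M :&: S = [set x] ->
  exists z, [/\ twin t x y z, z \notin S, N = [set x; z] &
    (M = [set x] /\ forall v, v != x -> t x v = t x z) \/
    (exists m, [/\ nmod t M, M = [set m; x], m != x & t m x = t x z])].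
Proof.
move=> hS xy yS aN N1 trN cM ncM trM.
have [xN xS hN] := trace1P trN; have [xM _ hM] := trace1P trM.
have [z zN zx] := card_gt1_other x N1.
have S0 : S != set0 by apply/set0Pn; exists x.
have zS : z \notin S by apply: contra zx => /hN ->.
have yN : y \notin N by apply/negP => /(hN _ yS)/eqP; rewrite eq_sym (negbTE xy).
have yM : y \notin M by apply/negP => /(hM _ yS)/eqP; rewrite eq_sym (negbTE xy).
have zy : z != y by apply: contraNneq yN => <-.
have key b : (forall u, u \in N -> u != x -> t x u = b) -> twin t x y z /\ N = [set x; z].
  move=> hb; have hm := almost_rest aN hb.
  have NE u : u \in N -> u != x -> u = z.
    move=> uN ux; apply: (hits_free hS hm) => //; rewrite ?inE ?ux ?zx //.
    by move=> s sS; rewrite !inE; apply/andP => -[/eqP sx /(hN _ sS)].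
  split; last first.
    apply/setP => u; rewrite !inE; apply/idP/orP => [uN|[/eqP->|/eqP->]] //.
    by case: (eqVneq u x) => ux; [left|right; apply/eqP/NE].
  split=> // [|v vx vy vz]; first exact: almost_outy aN zN zx.
  apply: (almost_out aN) => //; apply: contra vz => vN; exact/eqP/NE.
case/orP: ncM => [nM|/cards1P[x' Mx]]; last first.
  have {x' Mx} Mx : M = [set x].
    by move: xM; rewrite Mx inE => /eqP->.
  have hb v : v != x -> t x v = t x z.
    by move=> vx; apply: (comod_sees cM _ _ Mx); rewrite Mx inE.
  have [|h1 h2] := key (t x z); first by move=> u _; apply: hb.
  by exists z; split=> //; left.
have [mM M1 _] := nmodE nM.
(* [y] tells [x] from the rest of [N] but lies outside the module [M], so [M] and [N] share only
   [x]. *)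
have NM u : u \in N -> u != x -> u \notin M.
  move=> uN ux; apply/negP => uM; have := modl_in mM uM xM yM.
  by case: aN => _ _ _ ->//; case: (t y x).
have [m mMm mx] := card_gt1_other x M1.
have MN u : u \in M -> u != x -> u \notin N.
  by move=> uM ux; apply/negP => uN; move: (NM _ uN ux); rewrite uM.
(* Both sides equal [t u v]: [N] is uniform seen from [u], and [M] is uniform seen from [v]. *)
have e1 u v : u \in M -> u != x -> v \in N -> v != x -> t u x = t x v.
  move=> uM ux vN vx.
  have uy : u != y by apply: contraNneq yM => <-.
  have uN := MN _ uM ux; have vM := NM _ vN vx.
  rewrite -(modl_out ht mM uM xM vM); case: aN => _ _ h _; exact: h.
have [|h1 h2] := key (t m x); first by move=> u uN ux; rewrite -(e1 m u).
exists z; split=> //; right; exists m; split=> //; last exact: e1.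
have mD : modl t (M :\ x).
  apply/modlP => u v w /setD1P[ux uM] /setD1P[vx vM] wM.
  case: (eqVneq w x) => [->|wx].
    by rewrite (tour_sym ht ux) (tour_sym ht vx) (e1 u z) // (e1 v z).
  by apply: (modl_in mM) => //; move: wM; rewrite !inE wx.
apply/setP => u; rewrite !inE; apply/idP/orP => [uM|[/eqP->|/eqP->]] //.
case: (eqVneq u x) => ux; [by right|left]; apply/eqP/(hits_free hS mD) => //; rewrite ?inE ?ux ?mx //.
by move=> s sS; rewrite !inE; apply/andP => -[/eqP sx /(hM _ sS)].
Qed.

(* [almost_pair] fixes the orientation of the arc between [x] and its twin,
   whence the hypothesis [t x z1 = t x z2]. *)
Lemma twin_unique x y1 y2 z1 z2 : twin t x y1 z1 -> twin t x y2 z2 ->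
  t x z1 = t x z2 -> z1 != y2 -> z2 != y1 -> y1 != x -> y1 = y2.
Proof.
case=> z1x z1y d1 h1 [z2x z2y d2 h2] e n1 n2 y1x; apply/eqP; apply: contraT => y12.
case: (eqVneq z1 z2) => [zz|zz].
  move: d1; rewrite zz -(h2 y1) // 1?eq_sym //; by case: (t x y1).
have := h1 z2 z2x n2; rewrite eq_sym zz => /(_ isT).
have := h2 z1 z1x n1 zz; rewrite (tour_sym ht zz) e => ->; by case: (t z1 z2).
Qed.

(** [M] is not [[set y]], since [x] and [z] see [y] differently. If the module [M] missed [z], then
    [x] and [z] would disagree on all of [M] as they do on [y]. So [z] is in [M], and [x] can join
    [M] because it sees the outside as [z] does. *)
Lemma twin_module M x y z : twin t x y z -> comod t M -> noncomp t M ->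
  y \in M -> x \notin M ->
  [/\ nmod t M, z \in M, modl t (x |: M) & t x y = t x z].
Proof.
case=> zx zy d h cM ncM yM xM.
have yx : y != x by apply: mem_neq xM.
case/orP: ncM => [nM|/cards1P[y' Mx]]; last first.
  have {y' Mx} Mx : M = [set y] by move: yM; rewrite Mx inE => /eqP->.
  have := @comod_sees _ _ _ x z y cM xM _ Mx; rewrite Mx inE => /(_ zy).
  by rewrite (tour_sym ht (_ : x != y)) 1?eq_sym // (tour_sym ht zy) d; case: (t x y).
have [mM M1 _] := nmodE nM.
have zM : z \in M.
  apply: contraT => zM; have [m mMm my] := card_gt1_other y M1.
  have := h m (mem_neq mMm xM) my (mem_neq mMm zM).
  by rewrite (modl_in mM mMm yM xM) (modl_in mM mMm yM zM) d; case: (t x y).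
split=> //; last exact: modl_in mM _ _ _.
have hv v : v \notin x |: M -> t v x = t v z.
  rewrite !inE negb_or => /andP[vx vM].
  have vz : v != z by apply: contraNneq vM => ->.
  have vy : v != y by apply: contraNneq vM => ->.
  by rewrite (tour_sym ht (_ : x != v)) 1?eq_sym // h // -(tour_sym ht) // eq_sym.
apply/modlP => u u' v uM uM' vM.
have hu u0 : u0 \in x |: M -> t v u0 = t v z.
  move=> /setU1P[->|u0M]; first exact: hv.
  by apply: (modl_in mM) => //; move: vM; rewrite !inE negb_or => /andP[].
by rewrite !hu.
Qed.

(** [x] tells [y] from a third vertex of [S], so [M] itself is a module, and [M :\ x] lies in [N].
    Then [x |: N] is a module containing [S], so [N] consists of all vertices but [x]. *)
Lemma coalmost_private_pair S M N x y : hits t S -> 2 < #|S| -> x != y -> y \in S ->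
  almost t y x N -> ~: N :&: S = [set x] -> comod t M -> M :&: S = [set x] ->
  [/\ nmod t M, forall v, v != x -> v != y -> t x v = ~~ t x y &
      exists n, [/\ M = [set n; x], n != x & n != y]].
Proof.
move=> hS S3 xy yS aN trN cM trM.
have [xN xS hN] := trace1P trN; have [xM _ hM] := trace1P trM.
have S0 : S != set0 by apply/set0Pn; exists x.
have [w [wS wx wy]] := third_elt x y S3.
have inN s : s \in S -> s != x -> s \in N.
  by move=> sS; apply: contraR => sN; apply/eqP/hN; rewrite ?inE.
have [yN xN' h1 h2] := aN; have wN := inN _ wS wx.
have yM : y \notin M by apply/negP => /(hM _ yS)/eqP; rewrite eq_sym (negbTE xy).
have wM : w \notin M by apply/negP => /(hM _ wS)/eqP; rewrite (negbTE wx).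
have dw := h2 _ wN wy.
case/orP: cM => [nM|/nmodE[mK _ _]]; last first.
  have := modl_in mK (x := y) (y := w) (v := x).
  by rewrite !inE yM wM xM dw => /(_ isT isT isT); case: (t x y).
have [mM M1 _] := nmodE nM.
have NM v : v \in M -> v != x -> v \in N.
  move=> vM vx; apply: contraT => vN.
  have := h1 y w v yN wN vN vx.
  rewrite (modl_out ht mM vM xM yM) (modl_out ht mM vM xM wM) dw; by case: (t x y).
have mD : modl t (M :\ x).
  apply/modlP => u v w' /setD1P[ux uM] /setD1P[vx vM] w'M.
  case: (eqVneq w' x) => [->|wx'].
    by rewrite (h2 u) 1?(h2 v) ?NM //; apply: mem_neq yM.
  by apply: (modl_in mM) => //; move: w'M; rewrite !inE wx'.
have [n nM' nx] := card_gt1_other x M1.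
have ME v : v \in M -> v != x -> v = n.
  move=> vM vx; apply: (hits_free hS mD) => //; rewrite ?inE ?vx ?nx //.
  by move=> s sS; rewrite !inE; apply/andP => -[/eqP sx /(hM _ sS)].
have nN := NM _ nM' nx; have ny := mem_neq nM' yM.
have Nfull v : v != x -> v \in N.
  move=> vx; have : v \in x |: N.
    apply: (hits_full _ hS _ _ (ltnW S3)).
      apply/modlP => a b c aN' bN cN.
      have [cx {}cN] : c != x /\ c \notin N by move: cN; rewrite !inE negb_or => /andP[].
      have hx : t c x = t c n.
        apply: (modl_in mM) => //; apply: contra cN => cM; exact: NM.
      have hc d : d \in x |: N -> t c d = t c n.
        by case/setU1P => [->//|dN]; apply: h1.
      by rewrite !hc.
    by apply/subsetP => s sS; rewrite !inE; case: eqP => //= /eqP; apply: inN.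
  by rewrite !inE (negbTE vx).
split=> //.
- by move=> v vx vy; apply: h2 => //; apply: Nfull.
- exists n; split=> //; apply/setP => u; rewrite !inE.
  apply/idP/orP => [uM|[/eqP->|/eqP->]] //.
  by case: (eqVneq u x) => ux; [right|left; apply/eqP/ME].
Qed.

(** As [x] sees [y] unlike every other vertex, [M'] can only be [[set y]]. Then [x] and [y] both
    dominate all other vertices, or are both dominated by them. *)
Lemma coalmost_pair_module M' x y : comod t M' -> noncomp t M' ->
  y \in M' -> x \notin M' -> (forall v, v != x -> v != y -> t x v = ~~ t x y) ->
  modl t [set x; y].
Proof.
move=> cM ncM yM xM h; have yx := mem_neq yM xM.
case/orP: ncM => [/nmodE[mM M1 _]|/cards1P[y' Mx]].
  have [m mM' my] := card_gt1_other y M1.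
  have := h m (mem_neq mM' xM) my; rewrite (modl_in mM mM' yM xM); by case: (t x y).
have {y' Mx} Mx : M' = [set y] by move: yM; rewrite Mx inE => /eqP->.
have e v : v \notin [set x; y] -> t v x = t v y.
  rewrite !inE negb_or => /andP[vx vy].
  rewrite [LHS](tour_sym ht) 1?eq_sym // [RHS](tour_sym ht) 1?eq_sym // h //.
  rewrite (@comod_sees _ _ _ v x y cM _ xM Mx) ?Mx ?inE //.
  by rewrite (tour_sym ht (_ : x != y)) 1?eq_sym.
apply/modlP => a b v; rewrite !in_set2 => /orP[]/eqP-> /orP[]/eqP-> vn //.
- by apply: e; rewrite !inE.
- by apply/esym/e; rewrite !inE.
Qed.

End Flips.

(** * Private comodules of a minimal hitting set *)

Section Steps.

Variables (V : finType) (t : rel V).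
Hypothesis ht : is_tour t.
Implicit Types (A B C D K M N S : {set V}) (u v w x y z m : V).

Definition noncomp_private S x := [exists M, [&& comod t M, noncomp t M & M :&: S == [set x]]].

Lemma noncomp_privateP S x : reflect (exists M, [/\ comod t M, noncomp t M & M :&: S = [set x]]) (noncomp_private S x).
Proof.
apply: (iffP existsP) => -[M].
  by case/and3P => ? ? /eqP ?; exists M.
by case=> ? ? /eqP ?; exists M; apply/and3P.
Qed.

Lemma not_noncomp M : comod t M -> ~~ noncomp t M -> ~~ modl t M /\ nmod t (~: M).
Proof.
move=> cM; rewrite /noncomp negb_or => /andP[nM M1].
have nK : nmod t (~: M) by case/orP: cM => // h; rewrite h in nM.
split=> //; apply: contra nM => mM; rewrite /nmod mM /=.
have [x xM] := comod_neq0 cM.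
have M0 : 0 < #|M| by apply/card_gt0P; exists x.
apply/andP; split; first by lia.
by apply: contraTneq nK => ->; rewrite setCT /nmod cards0 andbF.
Qed.

(** If both failed, the complements of their private comodules would be modules sharing a third
    vertex of [S] and covering [S], hence covering everything. Then [Mx] is the difference of these
    two modules, so a module after all. *)
Lemma comp_unique S x y : minset (hits t) S -> 2 < #|S| -> x \in S -> y \in S ->
  x != y -> noncomp_private S x || noncomp_private S y.
Proof.
move=> mS S3 xS yS xy; have hS := minsetp mS; apply: contraT; rewrite negb_or.
case/andP => nx ny.
have [Mx cx tx] := hits_private mS xS; have [My cy ty] := hits_private mS yS.
have [|nmx /nmodE[kx _ _]] := not_noncomp cx.
  by apply: contra nx => h; apply/noncomp_privateP; exists Mx.
have [|nmy /nmodE[ky _ _]] := not_noncomp cy.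
  by apply: contra ny => h; apply/noncomp_privateP; exists My.
have [xMx _ hx] := trace1P tx; have [yMy _ hy] := trace1P ty.
have [w [wS wx wy]] := third_elt x y S3.
have wMx : w \notin Mx by apply: contra wx => /(hx _ wS)->.
have wMy : w \notin My by apply: contra wy => /(hy _ wS)->.
have yMx : y \notin Mx by apply: contra xy => /(hx _ yS)->.
have xMy : x \notin My by apply: contra xy => /(hy _ xS)->.
have full v : v \in ~: Mx :|: ~: My.
  apply: (hits_full _ hS _ _ (ltnW S3)).
    by apply: (@modlU _ _ _ _ w); rewrite ?inE.
  apply/subsetP => s sS; rewrite !inE -negb_and; apply/andP => -[/(hx _ sS) -> /(hy _ xS)/eqP].
  by rewrite (negbTE xy).
have e : Mx = ~: My :\: ~: Mx.
  by apply/setP => v; have := full v; rewrite !inE negbK; case: (v \in Mx); case: (v \in My).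
by case/negP: nmx; rewrite e; apply: (modlD ht (z := y)); rewrite ?inE ?negbK.
Qed.

(* Only four vertices matter: no 4-vertex tournament has all three of its
   balanced splits given by a module on one of the two sides. *)
Lemma three_splits a b c d C1 C2 C3 :
  comod t C1 -> comod t C2 -> comod t C3 ->
  [&& a \in C1, b \in C1, c \notin C1 & d \notin C1] ->
  [&& a \in C2, c \in C2, b \notin C2 & d \notin C2] ->
  [&& b \in C3, c \in C3, a \notin C3 & d \notin C3] -> False.
Proof.
have sp C p q r s : comod t C -> [&& p \in C, q \in C, r \notin C & s \notin C] ->
    (t r p = t r q /\ t s p = t s q) \/ (t p r = t p s /\ t q r = t q s).
  move=> cC /and4P[pC qC rC sC]; case/orP: cC => /nmodE[mC _ _]; [left|right].
    by split; apply: (modl_in mC).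
  by split; apply: (modl_in mC); rewrite ?inE ?negbK.
move=> c1 c2 c3 h1 h2 h3.
have := sp _ _ _ _ _ c1 h1; have := sp _ _ _ _ _ c2 h2; have := sp _ _ _ _ _ c3 h3.
case/and4P: h1 => a1 b1 c1' d1; case/and4P: h2 => a2 c2' b2 d2; case/and4P: h3 => b3 c3' a3 d3.
rewrite (tour_sym ht (mem_neq a1 c1')) (tour_sym ht (mem_neq a1 d1)).
rewrite (tour_sym ht (mem_neq b1 d1)) (tour_sym ht (mem_neq c2' d2)).
rewrite (tour_sym ht (mem_neq b1 c1')) (tour_sym ht (mem_neq a2 b2)).
case: (t a b); case: (t a c); case: (t a d); case: (t b c); case: (t b d); case: (t c d) => /=;
 move=> [[? ?]|[? ?]] [[? ?]|[? ?]] [[? ?]|[? ?]] //.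
Qed.

Lemma not_hits S : ~~ hits t S ->
  exists2 N, nmod t N & (forall s, s \in S -> s \notin N) \/ (forall s, s \in S -> s \in N).
Proof.
rewrite /hits negb_forall => /existsP[C]; rewrite negb_imply negbK => /andP[cC /eqP e].
have h s : s \in S -> s \notin C.
  by move=> sS; apply/negP => sC; have := in_set0 s; rewrite -e inE sS sC.
case/orP: cC => nC; [exists C => //; left | exists (~: C) => //; right] => // s sS.
by rewrite inE h.
Qed.

Lemma trace1_intro S N x : x \in S -> x \in N -> (forall s, s \in S -> s \in N -> s = x) ->
  N :&: S = [set x].
Proof.
move=> xS xN h; apply/setP => s; rewrite !inE; apply/andP/eqP => [[sN sS]|->//].
exact: h.
Qed.

End Steps.

(** * Reversals that shrink a hitting set of at least three vertices *)

Section Reduction.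

Variables (V : finType) (t : rel V).
Hypothesis ht : is_tour t.
Implicit Types (A B C D K M N S : {set V}) (u v w x y z m : V).

(** The common private comodule [M] makes [x] see its twins [z1] and [z2] alike, so [twin_unique]
    applies. *)
Lemma almost_partner_unique S M N1 N2 x y1 y2 : hits t S -> x != y1 -> x != y2 ->
  y1 \in S -> y2 \in S -> comod t M -> noncomp t M -> M :&: S = [set x] ->
  almost t x y1 N1 -> 1 < #|N1| -> N1 :&: S = [set x] ->
  almost t x y2 N2 -> 1 < #|N2| -> N2 :&: S = [set x] -> y1 = y2.
Proof.
move=> hS xy1 xy2 y1S y2S cM ncM trM a1 c1 tr1 a2 c2 tr2.
have [z1 [tw1 z1S _ o1]] := almost_pair ht hS xy1 y1S a1 c1 tr1 cM ncM trM.
have [z2 [tw2 z2S _ o2]] := almost_pair ht hS xy2 y2S a2 c2 tr2 cM ncM trM.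
have z1y2 : z1 != y2 by rewrite eq_sym (mem_neq y2S z1S).
have z2y1 : z2 != y1 by rewrite eq_sym (mem_neq y1S z2S).
apply: (twin_unique ht tw1 tw2) => //; last by rewrite eq_sym.
case: tw1 tw2 => z1x _ _ _ [z2x _ _ _].
case: o1 => [[Mx h1]|[m [_ Mm mx h1]]]; case: o2 => [[Mx' h2]|[m' [_ Mm' mx' h2]]].
- by rewrite (h2 z1).
- by move: mx'; rewrite -in_set1 -Mx Mm' !inE eqxx.
- by move: mx; rewrite -in_set1 -Mx' Mm !inE eqxx.
- suff e : m = m' by rewrite -h1 -h2 e.
  have : m' \in M by rewrite Mm' !inE eqxx.
  by rewrite Mm !inE (negbTE mx') orbF => /eqP.
Qed.

(** A module escaping the smaller set either contradicts [hits t S] or yields a comodule of [t] with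
    trace [[set x; y]] on [S]. *)
Lemma flip_pair_hits S x y : hits t S -> 2 < #|S| -> x \in S -> y \in S -> x != y ->
  noncomp_private t S x -> noncomp_private t S y -> (forall C, comod t C -> C :&: S != [set x; y]) ->
  hits (flip t x y) (S :\: [set x; y]).
Proof.
move=> hS S3 xS yS xy /noncomp_privateP[Mx [cx ncx trx]] /noncomp_privateP[My [cy ncy try]] htr.
have [w [wS wx wy]] := third_elt x y S3.
have [xMx _ hx] := trace1P trx; have [yMy _ hy] := trace1P try.
have yMx : y \notin Mx by apply: contra xy => /(hx _ yS)->.
have xMy : x \notin My by apply: contra xy => /(hy _ xS)->.
have htr' M : modl t M -> x \in M -> y \in M -> (forall s, s \in S -> s \in M -> s = x \/ s = y) -> False.
  move=> mM xM yM h.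
  have nM : nmod t M.
    apply: (nmod_intro mM xM yM xy (v := w)); apply/negP => /(h _ wS)[] /eqP.
      by rewrite (negbTE wx).
    by rewrite (negbTE wy).
  have := htr M; rewrite /comod nM => /(_ isT)/eqP; apply.
  apply/setP => s; rewrite !inE; apply/andP/orP => [[sM sS]|[]/eqP->//].
  by case: (h s sS sM) => ->; [left|right].
have side a b Ma Mb N : (a = x /\ b = y) \/ (a = y /\ b = x) ->
    a != b -> a \in S -> b \in S ->
    comod t Ma -> noncomp t Ma -> Ma :&: S = [set a] ->
    comod t Mb -> noncomp t Mb -> Mb :&: S = [set b] ->
    almost t a b N -> 1 < #|N| ->
    (forall s, s \in S :\: [set x; y] -> s \notin N) \/ (forall s, s \in S :\: [set x; y] -> s \in N) -> False.
  move=> ab anb aS bS ca nca tra cb ncb trb aN N1 hN.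
  have [aMa _ ha] := trace1P tra; have [bMb _ hb] := trace1P trb.
  have bMa : b \notin Ma by apply: contra anb => /(ha _ bS)->.
  have aMb : a \notin Mb by apply: contra anb => /(hb _ aS)->.
  have [aNa bNa _ _] := aN.
  have out s : s \in S -> s != a -> s != b -> s \in S :\: [set x; y].
    by case: ab => -[-> ->] sS sa sb; rewrite !inE negb_or sS ?sa ?sb.
  have fin M : modl t M -> a \in M -> b \in M -> (forall s, s \in S -> s \in M -> s = a \/ s = b) -> False.
    case: ab => -[-> ->]; first exact: htr'.
    move=> mM xM yM h; apply: (htr' M mM yM xM) => s sS sM; case: (h s sS sM); by [right|left].
  case: hN => hN.
    (* [N] avoids the smaller set: it is a pair of twins, and [a |: Mb] is a module with trace
       [[set a; b]]. *)
    have trN : N :&: S = [set a].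
      apply: trace1_intro => // s sS sN; apply/eqP; apply: contraT => sa.
      have sb := mem_neq sN bNa; by move: (hN _ (out s sS sa sb)); rewrite sN.
    have [z [tw _ _ _]] := almost_pair ht hS anb bS aN N1 trN ca nca tra.
    have [_ _ mM _] := twin_module ht tw cb ncb bMb aMb.
    apply: (fin _ mM); rewrite ?inE ?eqxx ?bMb ?orbT // => s sS /setU1P[->|]; first by left.
    by move/(hb _ sS); right.
  (* [N] contains the smaller set: then [[set b; a]] is itself a module. *)
  have trN : ~: N :&: S = [set b].
    apply: trace1_intro => //; first by rewrite inE.
    move=> s sS; rewrite inE => sN; apply/eqP; apply: contraT => sb.
    have sa : s != a by rewrite eq_sym (mem_neq aNa sN).
    by move: (hN _ (out s sS sa sb)); rewrite (negbTE sN).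
  have bna : b != a by rewrite eq_sym.
  have [_ h _] := coalmost_private_pair ht hS S3 bna aS aN trN cb trb.
  have mM := coalmost_pair_module ht ca nca aMa bMa h.
  by apply: (fin _ mM); rewrite ?inE ?eqxx ?orbT // => s sS; rewrite !inE => /orP[]/eqP; [right|left].
apply: contraT => /not_hits[N /nmodE[mN N1 NT] hN].
case: (flip_modl xy mN) => [[exy mtN]|aN|aN].
- have cN : comod t N by rewrite /comod /nmod mtN N1 NT.
  exfalso; case: (boolP (x \in N)) exy => [xN|xN] /esym yN.
    case: hN => hN.
      apply: (htr' N mtN xN yN) => s sS sN; case: (eqVneq s x) => sx; first by left.
      case: (eqVneq s y) => sy; first by right.
      by have := hN s; rewrite !inE negb_or sS sx sy sN => /(_ isT).
    have [s sS sN] := hits_out hS cN.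
    have sx : s != x by rewrite eq_sym (mem_neq xN sN).
    have sy : s != y by rewrite eq_sym (mem_neq yN sN).
    by have := hN s; rewrite !inE negb_or sS sx sy (negbTE sN) => /(_ isT).
  case: hN => hN.
    have [s sS sN] := hitsP _ _ hS _ cN.
    have sx : s != x by apply: mem_neq sN xN.
    have sy : s != y by apply: (mem_neq sN); rewrite yN.
    by have := hN s; rewrite !inE negb_or sS sx sy sN => /(_ isT).
  have := htr (~: N); rewrite comodC cN => /(_ isT)/eqP; apply.
  apply/setP => s; rewrite !inE; apply/andP/orP => [[sN sS]|[]/eqP->]; rewrite ?yN ?xS //.
  case: (eqVneq s x) => sx; first by left.
  case: (eqVneq s y) => sy; first by right.
  by have := hN s; rewrite !inE negb_or sS sx sy (negbTE sN) => /(_ isT).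
- by case: (side x y Mx My N) => //; left.
- by case: (side y x My Mx N) => //; [right | rewrite eq_sym].
Qed.

(** At least three vertices [a], [b], [c] of [S] have private comodules that are modules or
    singletons. If every pair of them were the trace of a comodule, a fourth vertex [d] of [S] would
    give the splits excluded by [three_splits]. *)
Lemma step_large S : minset (hits t) S -> 3 < #|S| ->
  exists x y S', [/\ x != y, hits (flip t x y) S' & #|S'|.+2 = #|S|].
Proof.
move=> mS S4; have hS := minsetp mS; have S3 := ltnW S4.
have W3 : 2 < #|[set x in S | noncomp_private t S x]|.
  have h : #|S :\: [set x in S | noncomp_private t S x]| <= 1.
    rewrite leqNgt; apply/negP => /card_gt1P[x [y [/setDP[xS nx] /setDP[yS ny] xy]]].
    move: nx ny; rewrite !inE xS yS /= => nx ny.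
    by have := comp_unique ht mS S3 xS yS xy; rewrite (negbTE nx) (negbTE ny).
  have := cardsID [set x in S | noncomp_private t S x] S.
  rewrite (setIidPr _); last by apply/subsetP => u; rewrite inE => /andP[].
  move: S4 h; clear; lia.
case/card_gt2P: W3 => a [b [c [[]]]]; rewrite !inE.
move=> /andP[aS na] /andP[bS nb] /andP[cS ncc] [ab bc ca].
have [d [dS da db dc]] : exists d, [/\ d \in S, d != a, d != b & d != c].
  have h1 : #|[set a; b; c]| <= 3 by rewrite cardsU !cards1 cards2; case: (_ != _); clear; lia.
  have h2 := subset_leq_card (subsetIr S [set a; b; c]).
  have : 0 < #|S :\: [set a; b; c]|.
    have := cardsID [set a; b; c] S; move: S4 h1 h2; clear; lia.
  case/card_gt0P => d; rewrite !inE !negb_or => /andP[/andP[/andP[? ?] ?] ?]; by exists d.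
suff [x [y [xS yS xy [nx ny htr]]]] : exists x y, [/\ x \in S, y \in S, x != y &
    [/\ noncomp_private t S x, noncomp_private t S y & forall C, comod t C -> C :&: S != [set x; y]]].
  exists x, y, (S :\: [set x; y]); split=> //; first exact: flip_pair_hits.
  have := cardsID [set x; y] S; rewrite (setIidPr _) ?cards2 ?xy.
    by move=> <-.
  by apply/subsetP => u; rewrite !inE => /orP[]/eqP->.
pose r x y := [exists C, comod t C && (C :&: S == [set x; y])].
have nr x y : ~~ r x y -> forall C, comod t C -> C :&: S != [set x; y].
  by rewrite negb_exists => /forallP h C cC; have := h C; rewrite cC.
case: (boolP (r a b)) => [/existsP[C1 /andP[c1 /eqP /setP e1]]|/nr h]; last by exists a, b.
case: (boolP (r b c)) => [/existsP[C3 /andP[c3 /eqP /setP e3]]|/nr h]; last by exists b, c.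
case: (boolP (r c a)) => [/existsP[C2 /andP[c2 /eqP /setP e2]]|/nr h]; last by exists c, a.
have ac : a != c by rewrite eq_sym.
have ba : b != a by rewrite eq_sym.
have cb : c != b by rewrite eq_sym.
have m C p q r0 s : (forall u, (u \in C :&: S) = (u \in [set p; q])) ->
   p \in S -> q \in S -> r0 \in S -> s \in S -> r0 != p -> r0 != q -> s != p -> s != q ->
   [&& p \in C, q \in C, r0 \notin C & s \notin C].
  move=> e pS qS rS sS rp rq sp sq.
  move: (e p) (e q) (e r0) (e s); rewrite !inE pS qS rS sS !andbT !eqxx orbT.
  by rewrite (negbTE rp) (negbTE rq) (negbTE sp) (negbTE sq) => -> -> -> ->.
exfalso; apply: (three_splits ht (a := a) (b := b) (c := c) (d := d) c1 c2 c3).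
- exact: m e1 _ _ _ _ _ _ _ _.
- by have := m _ _ _ b d e2 cS aS bS dS bc ba dc da; case/and4P => -> -> -> ->.
- exact: m e3 _ _ _ _ _ _ _ _.
Qed.

(** As [u] stays in the set, a module containing both or neither of [x] and [u] cannot escape. The
    escaping one separates them, and it or its complement has trace [[set x]]. *)
Lemma flip_drop_bad S x u : hits t S -> x \in S -> u \in S -> x != u ->
  ~~ hits (flip t x u) (S :\ x) ->
  (exists2 N, almost t x u N & 1 < #|N| /\ N :&: S = [set x]) \/
  (exists2 N, almost t u x N & ~: N :&: S = [set x]).
Proof.
move=> hS xS uS xu /not_hits[N /nmodE[mN N1 NT] hN].
have ux : u != x by rewrite eq_sym.
have uS' : u \in S :\ x by rewrite !inE ux.
case: (flip_modl xu mN) => [[exu mtN]|aN|aN].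
- have cN : comod t N by rewrite /comod /nmod mtN N1 NT.
  exfalso; case: hN => hN.
    have [s sS sN] := hitsP _ _ hS _ cN.
    case: (eqVneq s x) => sx; first by move: (hN u uS'); rewrite -exu -sx sN.
    by have := hN s; rewrite !inE sx sS sN => /(_ isT).
  have [s sS sN] := hits_out hS cN.
  case: (eqVneq s x) => sx; first by move: (hN u uS'); rewrite -exu -sx (negbTE sN).
  by have := hN s; rewrite !inE sx sS (negbTE sN) => /(_ isT).
- have [xN uN _ _] := aN; left; exists N => //; split=> //; apply: trace1_intro => // s sS sN.
  case: hN => hN; last by move: (hN u uS'); rewrite (negbTE uN).
  apply/eqP; apply: contraT => sx; by have := hN s; rewrite !inE sx sS sN => /(_ isT).
- have [uN xN _ _] := aN; right; exists N => //; apply: trace1_intro => //; first by rewrite inE.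
  move=> s sS; rewrite inE => sN.
  case: hN => hN; first by move: (hN u uS'); rewrite uN.
  apply/eqP; apply: contraT => sx; by have := hN s; rewrite !inE sx sS (negbTE sN) => /(_ isT).
Qed.

(** Two partners [y] and [w] are tried for the same [x]. Two failures by twins contradict the
    uniqueness of the partner; any other double failure gives contradictory arcs at [x]. *)
Lemma step_drop S : minset (hits t) S -> 2 < #|S| ->
  exists x y S', [/\ x != y, hits (flip t x y) S' & #|S'|.+1 = #|S|].
Proof.
move=> mS S3; have hS := minsetp mS.
have [x xS ncx] : exists2 x, x \in S & noncomp_private t S x.
  have /card_gt1P[x [y [xS yS xy]]] := ltnW S3.
  by case/orP: (comp_unique ht mS S3 xS yS xy) => h; [exists x | exists y].
have [y [yS yx _]] := third_elt x x S3.
have [w [wS wx wy]] := third_elt x y S3.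
have xy : x != y by rewrite eq_sym.
have xw : x != w by rewrite eq_sym.
suff : hits (flip t x y) (S :\ x) || hits (flip t x w) (S :\ x).
  have e : #|S :\ x|.+1 = #|S| by rewrite (cardsD1 x S) xS.
  by case/orP => h; [exists x, y, (S :\ x) | exists x, w, (S :\ x)].
apply: contraT; rewrite negb_or => /andP[h1 h2].
case/noncomp_privateP: ncx => M [cM ncM trM]; have [xM _ hM] := trace1P trM.
have ab u v N N' : u \in S -> v \in S -> u != x -> v != x ->
    almost t x u N -> 1 < #|N| -> N :&: S = [set x] ->
    almost t v x N' -> ~: N' :&: S = [set x] -> False.
  move=> uS vS ux vx aN N1 trN aN' trN'.
  have xu : x != u by rewrite eq_sym.
  have xv : x != v by rewrite eq_sym.
  have [nM hv [n [Mn nx nv]]] := coalmost_private_pair ht hS S3 xv vS aN' trN' cM trM.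
  have [z [[zx _ _ _] zS _ o]] := almost_pair ht hS xu uS aN N1 trN cM ncM trM.
  case: o => [[Mx _]|[m [_ Mm mx e]]].
    by move: nx; rewrite -in_set1 -Mx Mn !inE eqxx.
  have mv : m != v.
    have : m \in M by rewrite Mm !inE eqxx.
    by rewrite Mn !inE (negbTE mx) orbF => /eqP->.
  have zv : z != v by rewrite eq_sym (mem_neq vS zS).
  have xm : x != m by rewrite eq_sym.
  move: e; rewrite (tour_sym ht xm) (hv m) // (hv z) //; by case: (t x v).
case: (flip_drop_bad hS xS yS xy h1) => [[N aN [N1 trN]]|[N aN trN]];
case: (flip_drop_bad hS xS wS xw h2) => [[N' aN' [N1' trN']]|[N' aN' trN']].
- have e := almost_partner_unique hS xy xw yS wS cM ncM trM aN N1 trN aN' N1' trN'.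
  by move: wy; rewrite e eqxx.
- by case: (ab y w N N').
- by case: (ab w y N' N).
- have [_ hy [n [_ nx ny]]] := coalmost_private_pair ht hS S3 xy yS aN trN cM trM.
  have [_ hw _] := coalmost_private_pair ht hS S3 xw wS aN' trN' cM trM.
  have [nM _ [n' [Mn nx' nw]]] := coalmost_private_pair ht hS S3 xw wS aN' trN' cM trM.
  have ny' : n' != y.
    apply: contraNneq yx => e; apply/eqP/hM => //; by rewrite Mn -e !inE eqxx.
  move: (hy w wx wy) (hy n' nx' ny') (hw n' nx' nw) => -> ->; by case: (t x y).
Qed.

End Reduction.

(** * Hitting sets of two vertices: one reversal suffices *)

Definition sep (V : finType) (t : rel V) (x y : V) : Prop :=
  forall C : {set V}, comod t C -> (x \in C) = (y \notin C).

Section LastFlip.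

Variables (V : finType) (t : rel V).
Hypothesis ht : is_tour t.
Implicit Types (A B C D K M N S : {set V}) (u v w x y z m : V).

Lemma sep_sym x y : sep t x y -> sep t y x.
Proof. by move=> h C /h ->; rewrite negbK. Qed.

(** The complement of a comodule is a comodule, so a hitting pair has one vertex on each side. *)
Lemma sep_of_hits x y : hits t [set x; y] -> sep t x y.
Proof.
move=> hS C cC; have [s sS sC] := hitsP _ _ hS _ cC; have [s' sS' sC'] := hits_out hS cC.
move: sS sS'; rewrite !inE => /orP[]/eqP e /orP[]/eqP e'; move: sC sC'; rewrite e e'.
- by move=> ->.
- by move=> -> ->.
- by move=> -> /negbTE ->.
- by move=> ->.
Qed.

Lemma hits_of_sep x y : sep t x y -> hits t [set x; y].
Proof.
move=> h; apply/hitsP => C cC; case: (boolP (y \in C)) => yC.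
  by exists y; rewrite ?inE ?eqxx ?orbT.
by exists x; rewrite ?inE ?eqxx // (h C cC).
Qed.

Lemma sep_full x y M v : sep t x y -> x != y -> modl t M -> x \in M -> y \in M -> v \in M.
Proof.
move=> h xy mM xM yM; apply: (hits_full v (hits_of_sep h) mM); last by rewrite cards2 xy.
by apply/subsetP => s; rewrite !inE => /orP[]/eqP->.
Qed.

Lemma trace2 x y N : x \in N -> y \notin N -> N :&: [set x; y] = [set x].
Proof.
move=> xN yN; apply/setP => s; rewrite !inE; apply/andP/eqP => [[sN /orP[]/eqP//]|->].
  by move=> e; move: yN; rewrite -e sN.
by rewrite eqxx.
Qed.

Lemma flip_bad x y : sep t x y -> x != y -> ~~ hits (flip t x y) set0 ->
  (exists2 N, almost t x y N & 1 < #|N|) \/ (exists2 N, almost t y x N & 1 < #|N|).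
Proof.
move=> h xy /not_hits[N /nmodE[mN N1 NT] _].
case: (flip_modl xy mN) => [[exy mtN]|aN|aN]; [|by left; exists N|by right; exists N].
have /h : comod t N by rewrite /comod /nmod mtN N1 NT.
by rewrite exy; case: (y \in N).
Qed.

Lemma almost_pair_of_sep M N x y : sep t x y -> x != y -> almost t x y N -> 1 < #|N| ->
  comod t M -> noncomp t M -> x \in M ->
  exists z, [/\ twin t x y z, N = [set x; z] &
    (M = [set x] /\ forall v, v != x -> t x v = t x z) \/
    (exists m, [/\ nmod t M, M = [set m; x], m != x & t m x = t x z])].
Proof.
move=> h xy aN N1 cM ncM xM; have [xN yN _ _] := aN.
have yM : y \notin M by rewrite -(h _ cM).
have [|z [? _ ? ?]] := almost_pair ht (hits_of_sep h) xy _ aN N1 (trace2 xN yN) cM ncM (trace2 xM yM).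
  by rewrite !inE eqxx orbT.
by exists z.
Qed.

(** Counterpart of [coalmost_private_pair], with [w] in place of a third vertex of [S]. [N :|: K] is
    a module containing [x] and [y], hence everything; [K :&: N] is a module missing both, hence a
    single vertex. *)
Lemma almost_of_comp K N x y w : sep t x y -> x != y -> almost t y x N -> 1 < #|N| ->
  nmod t K -> x \in K -> w \notin K -> w != y ->
  (forall v, v != x -> v != y -> t x v = ~~ t x y) /\ exists2 m, m != x & K = [set m; x].
Proof.
move=> h xy aN N1 nK xK wK wy; have [yN xN h1 h2] := aN; have [mK K1 _] := nmodE nK.
have yK : y \notin K by rewrite -(h K) // /comod nK.
have [z0 z0N z0y] := card_gt1_other y N1; have [k kK kx] := card_gt1_other x K1.
have [z zK zN] : exists2 z, z \in K & z \in N.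
  case: (boolP (z0 \in K)) => z0K; first by exists z0.
  exists k => //; apply: contraT => kN; have := h1 z0 y k z0N yN kN kx.
  rewrite (modl_out ht mK kK xK z0K) (modl_out ht mK kK xK yK) h2 //; by case: (t x y).
have full v : v \in N :|: K.
  apply: (sep_full v h xy); rewrite ?inE ?xK ?yN ?orbT //.
  apply/modlP => a b c aU bU; rewrite inE negb_or => /andP[cN cK].
  have hc d : d \in N :|: K -> t c d = t c z.
    case/setUP => dd; last exact: modl_in mK _ _ _.
    by apply: h1 => //; rewrite eq_sym (mem_neq xK cK).
  by rewrite !hc.
have mP : modl t (K :&: N).
  apply/modlP => a b v /setIP[aK aN'] /setIP[bK bN]; rewrite inE negb_and => vP.
  case: (boolP (v \in K)) vP => vK /=; last by move=> _; apply: (modl_in mK).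
  move=> vN; case: (eqVneq v x) => [->|vx]; last exact: h1.
  by rewrite (h2 a) 1?(h2 b) //; [apply: mem_neq bK yK | apply: mem_neq aK yK].
have PE u : u \in K -> u \in N -> u = z.
  move=> uK uN; apply: (hits_free (hits_of_sep h) mP); rewrite ?inE ?uK ?zK //.
    by move=> s; rewrite !inE => /orP[]/eqP->; rewrite ?(negbTE xN) ?(negbTE yK) ?andbF.
  by apply/set0Pn; exists x; rewrite !inE eqxx.
have KN u : u \in K -> u != x -> u \in N.
  move=> uK ux; apply: contraT => uN.
  have wN : w \in N by move: (full w); rewrite inE (negbTE wK) orbF.
  have := h1 w y u wN yN uN ux.
  rewrite (modl_out ht mK uK xK wK) (modl_out ht mK uK xK yK) h2 //; by case: (t x y).
split=> [v vx vy|].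
  by apply: h2 => //; case/setUP: (full v) => // vK; apply: KN.
exists z; first exact: mem_neq zN xN.
apply/setP => u; rewrite !inE; apply/idP/orP => [uK|[]/eqP->//].
by case: (eqVneq u x) => ux; [right | left; apply/eqP/PE; rewrite ?KN].
Qed.

(** The orientation hypotheses exclude the failures in which the new module contains [yi] but not
    [x]. The other failures give [x] twins that it sees alike, so two of them contradict
    [twin_unique]. *)
Lemma pair_module_flip K x m y1 y2 : nmod t K -> K = [set m; x] -> m != x ->
  (forall C, comod t C -> C = K \/ C = ~: K) -> 4 < #|V| ->
  y1 \notin K -> y2 \notin K -> y1 != y2 -> t y1 x = t m x -> t y2 x = t m x ->
  hits (flip t x y1) set0 || hits (flip t x y2) set0.
Proof.
move=> nK eK mx hc V5 y1K y2K y12 e1 e2; apply: contraT; rewrite negb_or => /andP[b1 b2].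
have xK : x \in K by rewrite eK !inE eqxx orbT.
have cK : comod t K by rewrite /comod nK.
have K2 : #|K| = 2 by rewrite eK cards2 mx.
have key y : y \notin K -> t y x = t m x -> ~~ hits (flip t x y) set0 ->
    exists z, twin t x y z /\ t x z = t m x.
  move=> yK e b; have xy : x != y := mem_neq xK yK.
  have s : sep t x y.
    by move=> C /hc[]->; rewrite ?inE ?negbK xK (negbTE yK).
  case: (flip_bad s xy b) => -[N aN N1].
    have [|z [tw _ o]] := almost_pair_of_sep s xy aN N1 cK _ xK; first by rewrite /noncomp nK.
    exists z; split=> //; case: o => [[e' _]|[m' [_ e' m'x <-]]].
      by move: K2; rewrite e' cards1.
    suff -> : m' = m by [].
    have : m' \in K by rewrite e' !inE eqxx.
    by rewrite eK !inE (negbTE m'x) orbF => /eqP.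
  have [w wK wy] : exists2 w, w \notin K & w != y.
    have : 0 < #|~: (y |: K)|.
      have := cardsC (y |: K); have := cardsU1 y K; rewrite yK K2; move: V5; clear.
      by rewrite -cardsT; lia.
    case/card_gt0P => w; rewrite !inE negb_or => /andP[? ?]; by exists w.
  have [h _] := almost_of_comp s xy aN N1 nK xK wK wy.
  have my : m != y by rewrite eq_sym; apply: contraNneq yK => ->; rewrite eK !inE eqxx.
  have := h m mx my; move: e.
  have xm : x != m by rewrite eq_sym.
  rewrite (tour_sym ht xy) (tour_sym ht xm) => /negb_inj ->; by case: (t x m).
have [z1 [tw1 f1]] := key _ y1K e1 b1; have [z2 [tw2 f2]] := key _ y2K e2 b2.
have ne z y : y \notin K -> t y x = t m x -> t x z = t m x -> z != y.
  move=> yK e f; apply: contraTneq (mem_neq xK yK) => zy.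
  rewrite negbK; apply: contraT => xy; move: f; rewrite zy -e (tour_sym ht xy); by case: (t x y).
have y1x : y1 != x by rewrite eq_sym (mem_neq xK y1K).
have := twin_unique ht tw1 tw2 _ (ne _ _ y2K e2 f1) (ne _ _ y1K e1 f2) y1x.
by rewrite f1 f2 => /(_ erefl) e; move: y12; rewrite e eqxx.
Qed.

(** Of three vertices outside [K] two see [x] alike, and hence [m] as well. The arc between [m] and
    [x] decides at which of the two [pair_module_flip] applies. *)
Lemma pair_module_step K x m : nmod t K -> K = [set m; x] -> m != x ->
  (forall C, comod t C -> C = K \/ C = ~: K) -> 4 < #|V| ->
  exists p q, p != q /\ hits (flip t p q) set0.
Proof.
move=> nK eK mx hc V5; have [mK _ _] := nmodE nK.
have xK : x \in K by rewrite eK !inE eqxx orbT.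
have mK' : m \in K by rewrite eK !inE eqxx.
have xm : x != m by rewrite eq_sym.
have D3 : 2 < #|~: K|.
  have := cardsC K; rewrite eK cards2 mx -cardsT; move: V5; clear; rewrite -cardsT; lia.
case/card_gt2P: D3 => a [b [c [[]]]]; rewrite !inE.
move=> aK bK cK [ab bc ca].
have pigeon : exists y1 y2, [/\ y1 \notin K, y2 \notin K, y1 != y2 & t y1 x = t y2 x].
  case: (eqVneq (t a x) (t b x)) => [e|n1]; first by exists a, b.
  case: (eqVneq (t b x) (t c x)) => [e|n2]; first by exists b, c.
  exists c, a; split=> //; move: n1 n2; by case: (t a x); case: (t b x); case: (t c x).
have [y1 [y2 [y1K y2K y12 e]]] := pigeon.
have fin p q : p \in K -> q \in K -> p != q -> t y1 p = t q p -> t y2 p = t q p ->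
    K = [set q; p] -> exists p q, p != q /\ hits (flip t p q) set0.
  move=> pK qK pq f1 f2 e'; have qp : q != p by rewrite eq_sym.
  case/orP: (pair_module_flip nK e' qp hc V5 y1K y2K y12 f1 f2) => hh.
    by exists p, y1; split=> //; apply: mem_neq pK y1K.
  by exists p, y2; split=> //; apply: mem_neq pK y2K.
case: (eqVneq (t y1 x) (t m x)) => [f|f].
  by apply: (fin x m) => //; rewrite -e.
apply: (fin m x) => //; last by rewrite eK; apply/setP => u; rewrite !inE orbC.
  rewrite (modl_in mK mK' xK y1K) (tour_sym ht mx); move: f.
  by case: (t y1 x); case: (t m x).
rewrite (modl_in mK mK' xK y2K) -e (tour_sym ht mx); move: f.
by case: (t y1 x); case: (t m x).
Qed.

(* If every choice of [y] failed, every vertex other than [x] would dominate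
   its own almost-twin, which is impossible on four or more vertices. *)
Lemma singleton_step x : nmod t (~: [set x]) ->
  (forall C, comod t C -> C = [set x] \/ C = ~: [set x]) -> 4 < #|V| ->
  exists p q, p != q /\ hits (flip t p q) set0.
Proof.
move=> nx hc V5.
have cx : comod t [set x] by rewrite /comod nx orbT.
have cx' : comod t (~: [set x]) by rewrite comodC.
have x1 : noncomp t [set x] by rewrite /noncomp cards1 orbT.
have ncx : noncomp t (~: [set x]) by rewrite /noncomp nx.
case: (boolP [exists y, (x != y) && hits (flip t x y) set0]) => [/existsP[y /andP[? ?]]|].
  by exists x, y.
rewrite negb_exists => /forallP bad; exfalso.
have [b hb] : exists b, forall v, v != x -> t x v = b.
  have : 0 < #|~: [set x]| by rewrite cardsC1; move: V5; clear; lia.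
  case/card_gt0P => v0; rewrite !inE => v0x; exists (t x v0) => v vx.
  by apply: (comod_sees cx) => //; rewrite inE.
have key y : y != x -> exists z, [/\ z != x, z != y, t z y = ~~ b &
    forall v, v != x -> v != y -> v != z -> t z v = b].
  move=> yx; have xy : x != y by rewrite eq_sym.
  have s : sep t x y by move=> C /hc[]->; rewrite !inE eqxx ?negbK ?yx // (negbTE yx).
  have := bad y; rewrite xy /= => hbad.
  case: (flip_bad s xy hbad) => -[N aN N1].
    have [|z [[zx zy d h] _ _]] := almost_pair_of_sep s xy aN N1 cx x1; first by rewrite inE.
    exists z; split=> //; first by rewrite d hb.
    by move=> v vx vy vz; rewrite -h // hb.
  have [|z [_ _ o]] := almost_pair_of_sep (sep_sym s) yx aN N1 cx' ncx; first by rewrite !inE.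
  have : #|~: [set x]| <= 2.
    by case: o => [[-> _]|[m [_ -> _ _]]]; rewrite ?cards1 ?cards2 //; case: (_ != _).
  by rewrite cardsC1; move: V5; clear; lia.
have other A : #|A| <= 4 -> exists v, v \notin A.
  move=> A4; have : 0 < #|~: A| by have := cardsC A; move: V5 A4; clear; lia.
  by case/card_gt0P => v; rewrite inE; exists v.
have [y1] := other [set x] ltac:(by rewrite cards1); rewrite !inE => y1x.
have [z1 [z1x zy1 d1 h1]] := key y1 y1x.
have c4 (p q r s : V) : #|[set p; q; r; s]| <= 4.
  apply: leq_trans (leq_card_setU _ _) _; rewrite cards1 addn1 ltnS;
    apply: leq_trans (leq_card_setU _ _) _; rewrite cards1 addn1 ltnS cards2; by case: (_ != _).
(* The twin of such a [y2] must be [y1]. Two choices of [y2] then clash, since [y1] has a single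
   exceptional neighbour. *)
have claim y2 : y2 != x -> y2 != y1 -> y2 != z1 -> t y1 y2 = ~~ b /\
    forall v, v != x -> v != y2 -> v != y1 -> t y1 v = b.
  move=> y2x y21 y2z; have [z2 [z2x zy2 d2 h2]] := key y2 y2x.
  suff e : z2 = y1 by rewrite -e; split.
  apply/eqP; apply: contraT => z2y1.
  have y12 : y1 != y2 by rewrite eq_sym.
  have y1z2 : y1 != z2 by rewrite eq_sym.
  case: (eqVneq z2 z1) => zz.
    have := h2 y1 y1x y12 y1z2; rewrite zz d1; by case: (b).
  have zz' : z1 != z2 by rewrite eq_sym.
  have z1y2 : z1 != y2 by rewrite eq_sym.
  have := h1 z2 z2x z2y1 zz; have := h2 z1 z1x z1y2 zz'; rewrite (tour_sym ht zz') => <-.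
  by case: (t z1 z2).
(* [z1] is repeated to match the four-element form of [c4]. *)
have [y2] := other [set x; y1; z1; z1] (c4 _ _ _ _).
rewrite !inE !negb_or => /andP[/andP[/andP[y2x y21] y2z] _].
have [y3] := other [set x; y1; z1; y2] (c4 _ _ _ _).
rewrite !inE !negb_or => /andP[/andP[/andP[y3x y31] y3z] y32].
have [f2 _] := claim y2 y2x y21 y2z; have [_ f3] := claim y3 y3x y31 y3z.
have y23 : y2 != y3 by rewrite eq_sym.
by have := f3 y2 y2x y23 y21; rewrite f2; case: (b).
Qed.

(** If reversing the arc between [x] and [y] fails, the complement [K] of [M] is a two-element
    module. Minimality leaves [K] and [M] as the only comodules, so [pair_module_step] applies. *)
Lemma step_comp M x y : sep t x y -> x != y -> minset (fun C => comod t C && (y \in C)) M ->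
  ~~ noncomp t M -> 4 < #|V| -> exists p q, p != q /\ hits (flip t p q) set0.
Proof.
move=> s xy /minsetP[/andP[cM yM] mM] ncM V5.
have [nmM nK] := not_noncomp cM ncM; set K := ~: M in nK.
have xM : x \notin M by rewrite (s _ cM) yM.
have xK : x \in K by rewrite inE.
have yK : y \notin K by rewrite inE negbK.
have [b1|] := boolP (hits (flip t x y) set0); first by exists x, y.
move=> b1.
have [m mx eK] : exists2 m, m != x & K = [set m; x].
  have cK : comod t K by rewrite comodC.
  case: (flip_bad s xy b1) => -[N aN N1].
    have [|z [_ _ o]] := almost_pair_of_sep s xy aN N1 cK _ xK; first by rewrite /noncomp nK.
    case: o => [[e _]|[m [_ e mx _]]]; last by exists m.
    by have [_] := nmodE nK; rewrite e cards1.
  have [w wM wy] : exists2 w, w \in M & w != y.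
    apply: card_gt1_other; move: ncM; rewrite /noncomp negb_or => /andP[_].
    have : 0 < #|M| by apply/card_gt0P; exists y.
    by case: #|M| => [|[]].
  have wK : w \notin K by rewrite inE negbK.
  by have [] := almost_of_comp s xy aN N1 nK xK wK wy.
apply: (pair_module_step nK eK mx) => // C cC.
have main D : comod t D -> y \in D -> D = M.
  move=> cD yD; have xD : x \notin D by rewrite (s _ cD) yD.
  case: (boolP (m \in D)) => mD; last first.
    apply: mM; first by rewrite cD.
    apply/subsetP => u uD; rewrite -[u \in M]negbK -in_setC -/K eK !inE negb_or.
    by rewrite (mem_neq uD mD) (mem_neq uD xD).
  have mK : m \in K by rewrite eK !inE eqxx.
  have [mdK _ _] := nmodE nK.
  (* A module [D] would make [M], equal to [D :\: K], a module. If [~: D] is the module, minimality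
     against [M :&: D] gives [M \subset D], so [~: D] lies in [K] without [m] and is too small. *)
  case/orP: (cD) => [/nmodE[mdD _ _]|/nmodE[mdD D1 _]].
    exfalso; case/negP: nmM.
    have full v := sep_full v s xy (modlU mK mD mdK mdD).
    have -> : M = D :\: K.
      apply/setP => u; have := full; rewrite /K !inE negbK => /(_ u).
      rewrite !inE xM yD orbT => /(_ isT isT).
      by case: (u \in M); case: (u \in D).
    exact: (modlD ht xK xD mdD mdK).
  have xD' : x \in ~: D by rewrite inE.
  have mU := modlU xK xD' mdK mdD.
  have cU : comod t (~: (K :|: ~: D)).
    rewrite comodC /comod (nmod_intro mU (x := m) (y := x) (v := y)) //.
    - by rewrite inE mK.
    - by rewrite inE xK.
    - by rewrite !inE yD yM.
  have := mM (~: (K :|: ~: D)); rewrite cU !inE yD yM /= => /(_ isT) e.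
  have e' : M \subset D.
    rewrite -e; last by apply/subsetP => u; rewrite /K !inE; case: (u \in M).
    by apply/subsetP => u; rewrite /K !inE; case: (u \in M); case: (u \in D).
  have [u uD ux] := card_gt1_other x D1.
  exfalso; have : u \in K by rewrite inE; apply: contraL uD => uM; rewrite inE negbK (subsetP e').
  rewrite eK !inE (negbTE ux) orbF => /eqP um; by move: uD; rewrite um inE mD.
case: (boolP (y \in C)) => yC; first by right; rewrite /K setCK; apply: main.
by left; rewrite /K -(main (~: C)) ?setCK ?comodC ?inE.
Qed.

(** [x |: My] is a module containing [x] and [y], so [My] is everything but [x]. By minimality the
    only comodules are [[set x]] and its complement, as in [singleton_step]. *)
Lemma step_alpha My Mx x y : sep t x y -> x != y ->
  minset (fun C => comod t C && (y \in C)) My -> noncomp t My ->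
  comod t Mx -> noncomp t Mx -> x \in Mx -> 4 < #|V| ->
  (exists2 N, almost t x y N & 1 < #|N|) -> exists p q, p != q /\ hits (flip t p q) set0.
Proof.
move=> s xy /minsetP[/andP[cM yM] mM] ncM cx ncx xMx V5 [N aN N1].
have xM : x \notin My by rewrite (s _ cM) yM.
have [z [tw _ _]] := almost_pair_of_sep s xy aN N1 cx ncx xMx.
have [nM zM mU _] := twin_module ht tw cM ncM yM xM.
have full v := sep_full v s xy mU.
have eM : My = ~: [set x].
  apply/setP => u; rewrite !inE; have := full u; rewrite !inE eqxx yM orbT => /(_ isT isT).
  case: (eqVneq u x) => [-> _|_ /= ->//]; exact: negbTE.
have main C : comod t C -> y \in C -> C = ~: [set x].
  move=> cC yC; rewrite -eM; apply: mM; first by rewrite cC.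
  rewrite eM; apply/subsetP => u uC; rewrite !inE; apply: (mem_neq uC).
  by rewrite (s _ cC) yC.
apply: (@singleton_step x) => //; first by rewrite -eM.
move=> C cC; case: (boolP (y \in C)) => yC; first by right; apply: main.
by left; apply: setC_inj; apply: main; rewrite ?comodC ?inE.
Qed.

Lemma step_two S : minset (hits t) S -> #|S| = 2 -> 4 < #|V| ->
  exists p q, p != q /\ hits (flip t p q) set0.
Proof.
move=> mS S2 V5; have hS := minsetp mS.
have /cards2P[x [y [xy eS]]] : #|S| == 2 by rewrite S2.
have s : sep t x y by apply: sep_of_hits; rewrite -eS.
have ex u : u \in S -> exists M, minset (fun C => comod t C && (u \in C)) M.
  move=> uS; have [M cM trM] := hits_private mS uS; have [uM _ _] := trace1P trM.
  have [|M' mM' _] := @minset_exists _ (fun C => comod t C && (u \in C)) M.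
    by rewrite cM.
  by exists M'.
have [Mx mx] := ex x ltac:(by rewrite eS !inE eqxx).
have [My my] := ex y ltac:(by rewrite eS !inE eqxx orbT).
have yx : y != x by rewrite eq_sym.
have [ncx|ncx] := boolP (noncomp t Mx); last exact: step_comp (sep_sym s) yx mx ncx V5.
have [ncy|ncy] := boolP (noncomp t My); last exact: step_comp s xy my ncy V5.
have [b|b] := boolP (hits (flip t x y) set0); first by exists x, y.
have /andP[cx xMx] := minsetp mx; have /andP[cy yMy] := minsetp my.
case: (flip_bad s xy b) => bad.
  exact: step_alpha s xy my ncy cx ncx xMx V5 bad.
exact: step_alpha (sep_sym s) yx mx ncx cy ncy yMy V5 bad.
Qed.

End LastFlip.

(** * A hitting set with about half of the vertices *)

Section InitialHittingSet.

Variables (V : finType) (t : rel V).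
Hypothesis ht : is_tour t.
Implicit Types (A B C D K M N S : {set V}) (u v w x y z m : V).

Lemma comod_neqT C : comod t C -> C != setT.
Proof.
rewrite -comodC => /comod_neq0[x]; rewrite inE; apply: contraNneq => ->.
by rewrite inE.
Qed.

Lemma mincomod_eq C D : minset (comod t) C -> comod t D -> D \subset C -> D = C.
Proof. by move/minsetP => [_ h]; apply: h. Qed.

Lemma mincomod_small C A v x y : minset (comod t) C -> modl t A -> A \subset C ->
  v \in C -> v \notin A -> x \in A -> y \in A -> x = y.
Proof.
move=> mC mA sAC vC vA xA yA; apply/eqP; apply: contraT => xy.
have cA : comod t A by rewrite /comod (nmod_intro mA xA yA xy vA).
by move: vA; rewrite (mincomod_eq mC cA sAC) vC.
Qed.

(** If both are modules, minimality leaves one vertex in [C1 :&: C2] and one in [C1 :\: C2].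
    Otherwise a union of overlapping modules has as complement a comodule strictly inside [C1] or
    [C2]. *)
Lemma mincomod_meet C1 C2 x : minset (comod t) C1 -> minset (comod t) C2 -> C1 != C2 ->
  x \in C1 -> x \in C2 -> nmod t C1 && (#|C1| == 2).
Proof.
move=> m1 m2 n12 x1 x2; have c1 := minsetp m1; have c2 := minsetp m2.
have [a a1 a2] : exists2 a, a \in C1 & a \notin C2.
  by apply/subsetPn; apply: contra n12 => h; apply/eqP/(mincomod_eq m2).
have [b b2 b1] : exists2 b, b \in C2 & b \notin C1.
  by apply/subsetPn; apply: contra n12 => h; apply/eqP/esym/(mincomod_eq m1).
have mixed A B a' b' : minset (comod t) B -> nmod t A -> nmod t (~: B) -> x \in A -> x \in B ->
    a' \in A -> a' \notin B -> b' \in B -> b' \notin A -> False.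
  move=> mB /nmodE[mA _ _] /nmodE[mK _ _] xA xB a'A a'B b'B b'A.
  have a'K : a' \in ~: B by rewrite inE.
  have mU := modlU a'A a'K mA mK.
  have cU : comod t (~: (A :|: ~: B)).
    rewrite comodC /comod (nmod_intro mU (x := x) (y := a') (v := b')) //.
    - by rewrite inE xA.
    - by rewrite inE a'A.
    - exact: mem_neq xB a'B.
    - by rewrite !inE negb_or negbK b'A.
  have := mincomod_eq mB cU; have -> : ~: (A :|: ~: B) \subset B.
    by apply/subsetP => u; rewrite !inE negb_or negbK => /andP[].
  by move/(_ isT)/setP/(_ x); rewrite !inE xA xB.
case/orP: (c1) => h1; case/orP: (c2) => h2.
- have [[k1 _ _] [k2 _ _]] := (nmodE h1, nmodE h2).
  rewrite h1 /= -(cardsID C2 C1).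
  have -> : C1 :&: C2 = [set x].
    apply/setP => u; rewrite in_set1; apply/idP/eqP => [uI|->]; last by rewrite inE x1.
    apply: (mincomod_small m1 (modlI k1 k2) (subsetIl _ _) a1) => //.
    - by rewrite inE (negbTE a2) andbF.
    - by rewrite inE x1.
  have -> : C1 :\: C2 = [set a].
    apply/setP => u; rewrite in_set1; apply/idP/eqP => [uI|->]; last by rewrite inE a2.
    apply: (mincomod_small m1 (modlD ht b2 b1 k1 k2) (subsetDl _ _) x1) => //.
    - by rewrite inE x2.
    - by rewrite inE a2.
  by rewrite !cards1.
- by case: (mixed C1 C2 a b).
- by case: (mixed C2 C1 b a).
- have [[k1 _ _] [k2 _ _]] := (nmodE h1, nmodE h2).
  (* Disjoint complements would force [~: C1 = C2], against the common vertex [x]. *)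
  case: (boolP (~: C1 \subset C2)) => [s|/subsetPn[v vC1 vC2]].
    have := mincomod_eq m2 _ s; rewrite comodC c1 => /(_ isT) e.
    by move: x2; rewrite -e inE x1.
  have v2 : v \in ~: C2 by rewrite inE.
  have mU := modlU vC1 v2 k1 k2.
  have cU : comod t (~: (~: C1 :|: ~: C2)).
    rewrite comodC /comod (nmod_intro mU (x := a) (y := v) (v := x)) //.
    - by rewrite !inE a2 orbT.
    - by rewrite !inE; move: vC1; rewrite inE => ->.
    - by apply: (mem_neq a1); move: vC1; rewrite inE.
    - by rewrite !inE x1 x2.
  have := mincomod_eq m1 cU; have -> : ~: (~: C1 :|: ~: C2) \subset C1.
    by apply/subsetP => u; rewrite !inE negb_or !negbK => /andP[].
  by move/(_ isT)/setP/(_ a); rewrite !inE a1 a2.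
Qed.

(** Only a source or a sink can form a singleton comodule. *)
Definition extremes : {set V} := [set x | comod t [set x]].

(** By [mincomod_meet] these sets are pairwise disjoint; each has at least two vertices, and one
    representative of each is enough. *)
Definition isolated_mincomods : {set {set V}} :=
  [set C | [&& minset (comod t) C, 1 < #|C| & ~~ (nmod t C && (#|C| == 2))]].

Definition outdeg x := #|[set v | t x v]|.

(** Each of three such vertices would see the other two alike, which no orientation of a triangle
    allows. *)
Lemma card_extremes : #|extremes| <= 2.
Proof.
rewrite leqNgt; apply/negP => /card_gt2P[a [b [c [[]]]]]; rewrite !inE.
move=> ca cb cc [ab bc ca'].
have u x y z : comod t [set x] -> y != x -> z != x -> t x y = t x z.
  by move=> cx yx zx; apply: (comod_sees cx); rewrite ?inE.
have ba : b != a by rewrite eq_sym.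
have cb' : c != b by rewrite eq_sym.
have ac : a != c by rewrite eq_sym.
move: (u a b c ca ba ca') (u b a c cb ab cb') (u c a b cc ac bc).
rewrite (tour_sym ht ab) (tour_sym ht ac) (tour_sym ht cb').
by case: (t a b); case: (t a c); case: (t c b); rewrite ?(tour_sym ht ca').
Qed.

Lemma isolated_partition : partition isolated_mincomods (cover isolated_mincomods).
Proof.
apply/and3P; split=> //; last first.
  by rewrite inE cards0 andbF.
apply/trivIsetP => A B; rewrite !inE => /and3P[mA _ nA] /and3P[mB _ nB] AB.
rewrite -setI_eq0; apply/eqP/setP => x; rewrite !inE; apply/negbTE/negP => /andP[xA xB].
by move: nA; rewrite (mincomod_meet mA mB AB xA xB).
Qed.

Lemma extremes_isolated : [disjoint extremes & cover isolated_mincomods].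
Proof.
rewrite -setI_eq0; apply/eqP/setP => x; rewrite !inE; apply/negbTE/negP => /andP[cx].
case/bigcupP => B; rewrite inE => /and3P[mB B1 _] xB.
have := mincomod_eq mB cx; rewrite sub1set xB => /(_ isT) e.
by move: B1; rewrite -e cards1.
Qed.

Lemma card_isolated : #|isolated_mincomods|.*2 <= #|cover isolated_mincomods|.
Proof.
rewrite (card_partition isolated_partition) -muln2 -sum_nat_const; apply: leq_sum => B.
by rewrite inE => /and3P[].
Qed.

Lemma outdeg_pair a b : a != b -> modl t [set a; b] -> odd (outdeg a) = ~~ odd (outdeg b).
Proof.
have main x y : x != y -> modl t [set x; y] -> t x y -> odd (outdeg x) = ~~ odd (outdeg y).
  move=> xy mM txy.
  have e : [set v | t x v] = y |: [set v | t y v].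
    apply/setP => v; rewrite !inE; case: (eqVneq v y) => [->|vy] //=.
    case: (eqVneq v x) => [->|vx].
      by rewrite (tour_sym ht xy) txy; case: ht => ->.
    by apply: (modl_out ht mM); rewrite !inE ?eqxx ?orbT // negb_or vx vy.
  rewrite /outdeg e cardsU1 inE; case: ht => -> _; by rewrite /= oddD.
move=> ab mM; case: (boolP (t a b)) => tab; first exact: main.
have ba : b != a by rewrite eq_sym.
rewrite (main b a) ?negbK //; last by rewrite (tour_sym ht ab).
by rewrite setUC.
Qed.

(* A 2-element module consists of vertices with consecutive out-degrees, so
   either parity class meets it. *)
Lemma parity_hits (o : bool) : hits t (extremes :|:
  transversal isolated_mincomods (cover isolated_mincomods) :|:
  [set x in ~: (extremes :|: cover isolated_mincomods) | odd (outdeg x) == o]).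
Proof.
apply/hitsP => C cC; have [M mM sMC] := minset_exists cC; have cM := minsetp mM.
(* A minimal comodule [M] inside [C] is a singleton, an isolated one or a two-element module; the
   three parts of the set deal with these in turn. *)
suff [x xS xM] : exists2 x, x \in extremes :|:
  transversal isolated_mincomods (cover isolated_mincomods) :|:
  [set x in ~: (extremes :|: cover isolated_mincomods) | odd (outdeg x) == o] & x \in M.
  by exists x => //; apply: (subsetP sMC).
have [x0 x0M] := comod_neq0 cM.
have M0 : 0 < #|M| by apply/card_gt0P; exists x0.
case: (eqVneq #|M| 1) => [/eqP/cards1P[z eM]|M1].
  by exists z; rewrite ?eM !inE -?eM ?cM.
have {M0}M1 : 1 < #|M| by case: #|M| M0 M1 => [|[]].
case: (boolP (nmod t M && (#|M| == 2))) => [/andP[/nmodE[mdM _ _] M2]|nM]; last first.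
  have MI : M \in isolated_mincomods by rewrite inE mM M1.
  have /and3P[_ _ /forall_inP/(_ _ MI)/cards1P[x ex]] := transversalP isolated_partition.
  have : x \in transversal isolated_mincomods (cover isolated_mincomods) :&: M.
    by rewrite ex inE.
  by case/setIP => xT xM; exists x => //; rewrite !in_setU xT orbT.
have inU x : x \in M -> x \notin extremes :|: cover isolated_mincomods.
  move=> xM; rewrite in_setU; apply/norP; split.
    rewrite inE; apply/negP => cx; have := mincomod_eq mM cx; rewrite sub1set xM => /(_ isT) e.
    by move: M1; rewrite -e cards1.
  apply/negP => /bigcupP[B]; rewrite inE => /and3P[mB B1 nB] xB.
  case: (eqVneq B M) => [e|BM]; last by move: nB; rewrite (mincomod_meet mB mM BM xB xM).
  by move: nB; rewrite e M2 andbT /nmod mdM M1 (comod_neqT cM).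
case/cards2P: M2 => a [b [ab eM]]; rewrite eM in mdM.
have op := outdeg_pair ab mdM.
have fin x : x \in M -> odd (outdeg x) == o -> exists2 x, x \in extremes :|:
  transversal isolated_mincomods (cover isolated_mincomods) :|:
  [set x in ~: (extremes :|: cover isolated_mincomods) | odd (outdeg x) == o] & x \in M.
  move=> xM xo; exists x => //; apply/setUP; right.
  by rewrite inE in_setC (inU _ xM) xo.
have aM : a \in M by rewrite eM !inE eqxx.
have bM : b \in M by rewrite eM !inE eqxx orbT.
case: (eqVneq (odd (outdeg a)) o) => ao; first by apply: (fin a) => //; apply/eqP.
by apply: (fin b) => //; move: ao; rewrite op; case: (odd _); case: (o).
Qed.

Lemma initial_hits : exists2 S, hits t S & #|S|.*2 <= #|V| + 2.
Proof.
set I := isolated_mincomods; set Z := extremes; set U := ~: (Z :|: cover I).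
pose P (o : bool) := [set x in U | odd (outdeg x) == o].
have PU : #|P true| + #|P false| = #|U|.
  rewrite -(cardsID [set x | odd (outdeg x)] U); congr (_ + _); apply: eq_card => x;
    rewrite !inE; case: (odd _); rewrite ?andbT ?andbF //=.
have hT := card_transversal (transversalP isolated_partition).
have cZI : #|Z :|: cover I| = #|Z| + #|cover I|.
  by apply/eqP; rewrite (leq_card_setU Z (cover I)) extremes_isolated.
have cU := cardsC (Z :|: cover I).
(* Twice the size is at most [2|Z| + |cover I| + |U| = |Z| + |V|], and [|Z| <= 2]. *)
have bound o : #|P o|.*2 <= #|U| ->
   #|Z :|: transversal I (cover I) :|: P o|.*2 <= #|V| + 2.
  move=> h; have := card_extremes; have := card_isolated.
  have := leq_card_setU (Z :|: transversal I (cover I)) (P o).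
  have := leq_card_setU Z (transversal I (cover I)).
  rewrite hT -/I -/Z; move: h cZI cU; rewrite -/U; clear.
  move=> h c1 c2 [h1 _] [h2 _] h3 h4; lia.
case: (leqP #|P true| #|P false|) => h.
  by exists (Z :|: transversal I (cover I) :|: P true); [exact: parity_hits | apply: bound; lia].
by exists (Z :|: transversal I (cover I) :|: P false); [exact: parity_hits | apply: bound; lia].
Qed.

End InitialHittingSet.

(** * Counting the reversals needed to empty a hitting set *)

Definition reversed (V : finType) (t t' : rel V) : {set V * V} :=
  [set e | t e.1 e.2 && ~~ t' e.1 e.2].

Lemma reversed_flip (V : finType) (t t' : rel V) x y : is_tour t -> x != y ->
  #|reversed t t'| <= (#|reversed (flip t x y) t'|).+1.
Proof.
move=> ht xy.
have s : reversed t t' \subset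
    (if t x y then (x, y) else (y, x)) |: reversed (flip t x y) t'.
  apply/subsetP => -[a b]; rewrite !inE /= /flip => /andP[tab ->]; rewrite andbT tab /=.
  case: (eqVneq a x) => [ax|_]; case: (eqVneq b y) => [by_|_] /=.
  - by rewrite -ax -by_ tab eqxx.
  - by rewrite ax (negbTE xy) orbT.
  - by rewrite by_ (eq_sym y) (negbTE xy) andbF orbT.
  - case: (eqVneq a y) => [ay|_] /=; last by rewrite orbT.
    case: (eqVneq b x) => [bx|_] /=; last by rewrite orbT.
    have yx : y != x by rewrite eq_sym.
    by rewrite (tour_sym ht yx) -ay -bx tab /= ay bx eqxx.
apply: leq_trans (subset_leq_card s) _; rewrite cardsU1; case: (_ \notin _) => //=.
Qed.

(** A single vertex cannot meet both its private comodule and the complement. *)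
Lemma minset_hits_neq1 (V : finType) (t : rel V) S : minset (hits t) S -> #|S| != 1.
Proof.
move=> mS; apply/negP => /cards1P[x eS].
have [|M cM trM] := @hits_private _ _ _ x mS; first by rewrite eS inE.
have [s sS sM] := hits_out (minsetp mS) cM.
have [xM _ _] := trace1P trM; move: sS sM; rewrite eS inE => /eqP ->.
by rewrite xM.
Qed.

(** Induction on [s]: from four vertices on, one reversal saves two; three vertices take one
    reversal to reach two, and two take one more, matching [uphalf 3 = 2]. *)
Lemma reverse_few (V : finType) s (t : rel V) S : 4 < #|V| -> is_tour t -> hits t S ->
  #|S| <= s -> exists t', [/\ is_tour t', hits t' set0 & #|reversed t t'| <= uphalf s].
Proof.
move=> V5; elim/ltn_ind: s t S => s IH t S ht hS Ss.
have [S0 mS0 sS0] := minset_exists hS.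
have S0s : #|S0| <= s := leq_trans (subset_leq_card sS0) Ss.
have n1 := minset_hits_neq1 mS0.
case: (ltnP 3 #|S0|) => [S4|S3].
  have [x [y [S' [xy hS' cS']]]] := step_large ht mS0 S4.
  have ls : #|S'| < s by apply: leq_trans S0s; rewrite -cS' leqnSn.
  have [t' [ht' h0 d]] := IH _ ls _ _ (flip_tour ht xy) hS' (leqnn _).
  exists t'; split=> //; apply: leq_trans (reversed_flip _ ht xy) _.
  move: d S0s; rewrite -cS'; clear; lia.
case: (eqVneq #|S0| 3) => [e3|n3].
  have [|x [y [S' [xy hS' cS']]]] := step_drop ht mS0; first by rewrite e3.
  have e2 : #|S'| = 2 by move: cS'; rewrite e3 => -[].
  have ls : #|S'| < s by rewrite e2 -e3.
  have [t' [ht' h0 d]] := IH _ ls _ _ (flip_tour ht xy) hS' (leqnn _).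
  exists t'; split=> //; apply: leq_trans (reversed_flip _ ht xy) _.
  move: d S0s; rewrite e2 e3; clear; rewrite /= => d s3; apply: leq_trans (uphalf_leq s3).
  by rewrite /= ltnS.
case: (eqVneq #|S0| 2) => [e2|n2].
  have [x [y [xy h0]]] := step_two ht mS0 e2 V5.
  exists (flip t x y); split=> //; first exact: flip_tour.
  apply: leq_trans (reversed_flip _ ht xy) _.
  have -> : #|reversed (flip t x y) (flip t x y)| = 0.
    by apply/eqP; rewrite cards_eq0; apply/eqP/setP => e; rewrite !inE andbN.
  by move: S0s; rewrite e2; case: s {IH Ss} => [|[]].
have e0 : S0 = set0.
  by apply/eqP; rewrite -cards_eq0; move: S3 n1 n2 n3; case: #|S0| => [|[|[|[]]]].
exists t; split=> //; first by rewrite -e0 (minsetp mS0).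
have -> : #|reversed t t| = 0.
  by apply/eqP; rewrite cards_eq0; apply/eqP/setP => e; rewrite !inE andbN.
by [].
Qed.

(** * Return to [tournament] records and the decomposability index *)

Lemma arcs_tour (V : finType) (T : tournament V) : is_tour (fun x y => (x, y) \in arcs T).
Proof.
split=> [x|x y xy]; first exact/negbTE/arcs_irr.
by have := arcs_tot T xy; do 2![case: (_ \in arcs T)].
Qed.

Lemma indecomposable_hits (V : finType) (T : tournament V) :
  indecomposable T <-> hits (fun x y => (x, y) \in arcs T) set0.
Proof.
split=> [h|/hitsP h M hM].
  apply/hitsP => C cC.
  suff [M /nmodE[/modlP mM M1 MT]] : exists M, nmod (fun x y => (x, y) \in arcs T) M.
    case: (h M mM) => [e|[x e]|e]; move: M1 MT; rewrite e ?cards0 ?cards1 ?eqxx //.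
  by case/orP: cC => ?; [exists C | exists (~: C)].
case: (boolP (nmod (fun x y => (x, y) \in arcs T) M)) => [nM|].
  by have [|x] := h M; rewrite ?inE // /comod nM.
have mM : modl (fun x y => (x, y) \in arcs T) M by apply/modlP.
rewrite /nmod mM /= negb_and negbK -leqNgt leq_eqVlt => /orP[/orP[/cards1P[x ->]|]|/eqP->].
- by apply: Or32; exists x.
- by rewrite ltnS leqn0 cards_eq0 => /eqP->; apply: Or31.
- exact: Or33.
Qed.

(** A decidable form, from which [ex_minnP] can extract the least [m]. *)
Lemma indec_afterP (V : finType) (T : tournament V) m : reflect (indec_after T m)
  [exists B : {set V * V}, [&& B \subset arcs T, #|B| == m &
     hits (fun x y => (x, y) \in inv_arcs T B) set0]].
Proof.
apply: (iffP existsP) => [[B /and3P[sB /eqP cB hB]]|[B [sB [cB iB]]]].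
  by exists B, sB; split=> //; apply/indecomposable_hits.
exists B; rewrite sB cB eqxx; exact/(indecomposable_hits (Inv sB)).
Qed.

Lemma hits_ext (V : finType) (t t' : rel V) S : t =2 t' -> hits t S = hits t' S.
Proof.
move=> e; have mE M : modl t M = modl t' M.
  by apply/modlP/modlP => h x y v ? ? ?; [rewrite -!e | rewrite !e]; apply: h.
by apply: eq_forallb => C; rewrite /comod /nmod !mE.
Qed.

Lemma indec_after_upper (V : finType) (T : tournament V) : 4 < #|V| ->
  exists2 m, indec_after T m & m <= ceil_div #|V|.+1 4.
Proof.
move=> V5; have ht := arcs_tour T; have [S hS cS] := initial_hits ht.
have [t' [ht' h0 d]] := reverse_few V5 ht hS (leqnn _).
exists #|reversed (fun x y => (x, y) \in arcs T) t'|; last first.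
  (* [2|S| <= |V| + 2] bounds [uphalf |S|] by the floor of [(|V| + 4) / 4], which is the ceiling of
     [(|V| + 1) / 4]. *)
  apply: leq_trans d _.
  have := ceil_div_leq #|V|.+1 (ceil_div #|V|.+1 4) (isT : 0 < 4); rewrite leqnn => /esym.
  move: (ceil_div _ _) => c h; clear -h cS; lia.
apply/indec_afterP; apply/existsP; exists (reversed (fun x y => (x, y) \in arcs T) t').
apply/and3P; split=> //.
  by apply/subsetP => -[a b]; rewrite inE => /andP[].
rewrite -(@hits_ext _ t') // => x y; rewrite in_inv_arcs !inE /=.
case: (eqVneq x y) => [->|xy].
  by case: ht ht' => i _ [i' _]; rewrite i i'.
rewrite (tour_sym ht xy) (tour_sym ht' xy); by case: (_ \in _); case: (t' x y).
Qed.

Lemma decomposability_index_exists (V : finType) (T : tournament V) : 4 < #|V| ->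
  exists2 k, decomposability_index T k & k <= ceil_div #|V|.+1 4.
Proof.
move=> V5; have [m /indec_afterP hm mc] := indec_after_upper T V5.
have ex : exists m, [exists B : {set V * V}, [&& B \subset arcs T, #|B| == m &
     hits (fun x y => (x, y) \in inv_arcs T B) set0]] by exists m.
case: (ex_minnP ex) => k /indec_afterP hk kmin; exists k; last exact: leq_trans (kmin _ hm) mc.
by split=> // j /indec_afterP; apply: kmin.
Qed.

(** * The lower bound for transitive tournaments *)

Section Transitive.

Variable n : nat.

Definition lt_arcs : {set 'I_n * 'I_n} := [set e : 'I_n * 'I_n | e.1 < e.2].

Lemma lt_arcs_irr x : (x, x) \notin lt_arcs.
Proof. by rewrite inE ltnn. Qed.

Lemma lt_arcs_tot x y : x != y -> ((x, y) \in lt_arcs) (+) ((y, x) \in lt_arcs).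
Proof. by rewrite !inE -val_eqE /=; case: ltngtP. Qed.

Definition transitive_tournament := Tournament lt_arcs_irr lt_arcs_tot.

Definition endpoints (B : {set 'I_n * 'I_n}) : {set 'I_n} :=
  [set e.1 | e in B] :|: [set e.2 | e in B].

Lemma card_endpoints B : #|endpoints B| <= #|B|.*2.
Proof.
have [h _] := leq_card_setU [set e.1 | e in B] [set e.2 | e in B].
apply: leq_trans h _; rewrite -addnn; apply: leq_add; exact: leq_imset_card.
Qed.

Variable B : {set 'I_n * 'I_n}.
Hypothesis sB : B \subset arcs transitive_tournament.
Hypothesis iB : indecomposable (Inv sB).
Hypothesis n3 : 2 < n.

Lemma inv_untouched v x : (x \notin endpoints B) || (v \notin endpoints B) ->
  ((v, x) \in arcs (Inv sB)) = (v < x).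
Proof.
move=> h; have [/negbTE h1 /negbTE h2] : (v, x) \notin B /\ (x, v) \notin B.
  by split; apply: contraL h => h; rewrite negb_or !negbK !inE;
    rewrite ?(imset_f (fun e => e.1) h) ?(imset_f (fun e => e.2) h) ?orbT.
by rewrite [arcs _]/(inv_arcs _ B) in_inv_arcs h1 h2 orbF andbT inE.
Qed.

Lemma not_trivial (M : {set 'I_n}) : 1 < #|M| -> M != setT -> ~ is_module (Inv sB) M.
Proof.
move=> M1 MT /iB[e|[x e]|e]; move: M1 MT; by rewrite e ?cards0 ?cards1 ?eqxx.
Qed.

(** An untouched first or last vertex stays a source or a sink, which makes the other vertices a
    nontrivial module. *)
Lemma extreme_touched (x : 'I_n) : (forall v : 'I_n, x <= v) \/ (forall v : 'I_n, v <= x) ->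
  x \in endpoints B.
Proof.
move=> hx; apply: contraT => xW; exfalso.
apply: (@not_trivial (~: [set x])).
- by rewrite cardsC1 card_ord; move: n3; clear; lia.
- by apply/eqP => /setP/(_ x); rewrite !inE eqxx.
move=> a b v aM bM; rewrite in_setC in_set1 negbK => /eqP ->.
rewrite !inv_untouched ?xW ?orbT //; move: aM bM; rewrite !in_setC !in_set1 => ax bx.
move: ax bx; rewrite -!val_eqE /=.
by case: hx => h; have := h a; have := h b; clear; lia.
Qed.

(** If both were untouched, every other vertex would still see them alike, and they would form a
    module. *)
Lemma consecutive_touched (x y : 'I_n) : y = x.+1 :> nat ->
  (x \in endpoints B) || (y \in endpoints B).
Proof.
move=> e; apply: contraT; rewrite negb_or => /andP[xW yW]; exfalso.
have xy : x != y by rewrite -val_eqE /= e; clear; lia.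
apply: (@not_trivial [set x; y]).
- by rewrite cards2 xy.
- apply/eqP => eT; have := cardsT 'I_n; rewrite -eT cards2 xy card_ord.
  by move: n3; clear; lia.
have main a v : a \in [set x; y] -> v \notin [set x; y] ->
    ((v, a) \in arcs (Inv sB)) = (v < x).
  move=> aM; rewrite !in_set2 negb_or -!val_eqE /= => vv; rewrite inv_untouched;
    move: aM; rewrite in_set2 -!val_eqE /= => aa.
    by case/orP: aa => /eqP->; move: vv; rewrite e; clear; lia.
  by case/orP: aa => /eqP/val_inj ->; rewrite ?xW ?yW.
by move=> a b v aM bM vM; rewrite !main.
Qed.

(* Each of the n+1 gaps around and between consecutive vertices is adjacent to
   an endpoint, and each endpoint is adjacent to two gaps. *)
Lemma transitive_lower : n.+1 <= #|B| * 4.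
Proof.
suff h : n.+1 <= #|endpoints B|.*2 by have := card_endpoints B; move: h; clear; lia.
(* Gaps are numbered from 0 to [n]: [f] sends a vertex to the gap before it, [g] to the gap after
   it. *)
pose f (x : 'I_n) := widen_ord (leqnSn n) x; pose g (x : 'I_n) := lift ord0 x.
have s : [set: 'I_n.+1] \subset f @: endpoints B :|: g @: endpoints B.
  apply/subsetP => j _.
  have inf (x : 'I_n) : x = j :> nat -> x \in endpoints B -> j \in f @: endpoints B :|: g @: endpoints B.
    by move=> e xW; apply/setUP; left; apply/imsetP; exists x => //; apply: val_inj.
  have ing (x : 'I_n) : x.+1 = j :> nat -> x \in endpoints B -> j \in f @: endpoints B :|: g @: endpoints B.
    by move=> e xW; apply/setUP; right; apply/imsetP; exists x => //; apply: val_inj.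
  have jn : j <= n by rewrite -ltnS.
  case: (posnP j) => [j0|jpos].
    have j1 : j < n by rewrite j0; move: n3; clear; lia.
    by apply: (inf (Ordinal j1)) => //; apply: extreme_touched; left => v /=; rewrite j0.
  have jp : j.-1 < n by rewrite prednK.
  case: (ltnP j n) => jn'.
    have := @consecutive_touched (Ordinal jp) (Ordinal jn'); rewrite /= prednK // => /(_ erefl).
    by case/orP; [apply: ing | apply: inf]; rewrite /= ?prednK.
  apply: (ing (Ordinal jp)); rewrite /= ?prednK //; apply: extreme_touched; right => v /=.
  by rewrite -ltnS prednK // (leq_trans (ltn_ord v)).
have := subset_leq_card s; rewrite cardsT card_ord => h.
apply: leq_trans h _; have [h _] := leq_card_setU (f @: endpoints B) (g @: endpoints B).
apply: leq_trans h _; rewrite -addnn; apply: leq_add; exact: leq_imset_card.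
Qed.

End Transitive.

Theorem theorem1 (n : nat) (n_ge5 : 5 <= n) :
  max_decomposability_index n (ceil_div n.+1 4).
Proof.
split; last first.
  move=> V T Vn; have [|k hk kc] := @decomposability_index_exists V T; first by rewrite Vn.
  by exists k; rewrite -Vn.
(* The index of the transitive tournament is at most the claimed value by the general upper bound,
   and at least that value by [transitive_lower]. *)
exists 'I_n, (transitive_tournament n); split; first exact: card_ord.
have [|k hk kc] := decomposability_index_exists (transitive_tournament n); first by rewrite card_ord.
rewrite card_ord in kc; suff -> : ceil_div n.+1 4 = k by [].
apply/eqP; rewrite eqn_leq kc andbT ceil_div_leq //.
case: hk => -[B [sB [<- iB]]] _; apply: (transitive_lower iB).
by move: n_ge5; clear; lia.
Qed.
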